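(* Let $W$ be a graphon with $\|W\|_1=1$ and $\|W\|_2<\infty$, let $0<\rho,\kappa\le1$ and $n\in\mathbb N$, let $G=G_n(\rho W)$ and $Q=Q_n(\rho W)$ (generated from the same latent points), and let $\widehat W=(\hat{\mathbf p},\hat B)$ be the output of the least squares algorithm with input $G$ and parameter $\kappa$. If $n\kappa>1$ and $\frac{1+\log(1/\kappa)}{\kappa^2}=O(\rho n)$, then \[ \hat\delta_2\big(M_n(\widehat W),Q\big)\le\hat\varepsilon^{(2)}_{\ge\kappa}(Q)+O_p\left(\rho\sqrt[4]{\frac{1+\log(1/\kappa)}{\kappa^2\rho n}}\right), \] where the constant implicit in $O_p$ depends on $\|W\|_2$. Moreover, if $\rho=\rho_n$ satisfies $n\rho_n\to\infty$ and $\rho_n\to0$, then almost surely, for $n$ large enough and all $\kappa$ with $n\kappa>1$ and $\frac{1+\log(1/\kappa)}{\kappa^2}=O(\rho n)$, \[ \hat\delta_2\big(M_n(\widehat W),Q\big)\le\hat\varepsilon^{(2)}_{\ge\kappa}(Q)+O\left(\rho\sqrt[4]{\frac{1+\log(1/\kappa)}{\kappa^2\rho n}}\right), \] with the implicit constant depending on $\|W\|_2$.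
   Context: A graphon over a probability space $(\Omega,\mathcal F,\pi)$ is a measurable symmetric $W:\Omega\times\Omega\to[0,\infty)$ with $\|W\|_1<\infty$. Given $\rho$, choose $x_1,\dots,x_n$ i.i.d. from $\pi$; $Q_n(\rho W)$ is the $n\times n$ matrix with entries $\min\{1,\rho W(x_i,x_j)\}$ for $i\ne j$ and $0$ on the diagonal; $G_n(\rho W)$ is the random graph on $[n]$ including edge $\{i,j\}$ independently with probability $(Q_n)_{ij}$. For $n\times n$ matrices, $\|A\|_p^p=\frac1{n^2}\sum_{i,j}|A_{ij}|^p$, and $\hat\delta_2(A,B)=\min_\sigma\|A^\sigma-B\|_2$ over permutations $\sigma$ of $[n]$, with $(A^\sigma)_{ij}=A_{\sigma(i)\sigma(j)}$. For $\pi:[n]\to[k]$ (classes $V_i=\pi^{-1}(i)$) and a $k\times k$ matrix $B$, $B^\pi$ is the $n\times n$ matrix with entries $B_{\pi(i)\pi(j)}$. $\mathcal A_{n,\ge\kappa}$ is the set of $n\times n$ matrices of the form $B^\pi$ with $\pi$ having all non-empty classes of size at least $\lfloor\kappa n\rfloor$, and $\hat\varepsilon^{(2)}_{\ge\kappa}(H)=\min_{B\in\mathcal A_{n,\ge\kappa}}\|H-B\|_2$. Least squares algorithm: with $k=\lceil n/\lfloor n\kappa\rfloor\rceil$, choose $(\hat\pi,\hat B)\in\operatorname{argmin}\|A(G)-B^\pi\|_2$ over all $k\times k$ matrices $B$ and all $\pi:[n]\to[k]$ whose non-empty classes have size at least $\lfloor\kappa n\rfloor$ ($A(G)$ the adjacency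 matrix); set $\hat p_i=|V_i(\hat\pi)|/n$, output $\widehat W=(\hat{\mathbf p},\hat B)$. $M_n(\widehat W)$ denotes the $n\times n$ matrix $\hat B^{\hat\pi}\in\mathcal A_{n,\ge\kappa}$ representing this block model. $X=O_p(Y)$ means: for every $\varepsilon>0$ there is $M$ with $|X|\le M|Y|$ with probability at least $1-\varepsilon$. *)

(* Defs.v *)
From HB Require Import structures.
From mathcomp Require Import all_boot all_order all_algebra all_fingroup.
From mathcomp Require Import all_classical all_reals all_analysis.

Set Implicit Arguments.
Unset Strict Implicit.
Unset Printing Implicit Defensive.

Import Order.TTheory GRing.Theory Num.Theory.
Local Open Scope classical_set_scope.
Local Open Scope ring_scope.

Section Defs.
Variable R : realType.

Definition mnorm2 (n : nat) (A : 'M[R]_n) : R :=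
  Num.sqrt ((n%:R ^+ 2)^-1 * \sum_(i < n) \sum_(j < n) (A i j) ^+ 2).

Definition mx_perm (n : nat) (A : 'M[R]_n) (s : 'S_n) : 'M[R]_n :=
  \matrix_(i, j) A (s i) (s j).

(** hat delta_2(A,B) = min over permutations sigma of ||A^sigma - B||_2
    (minimum over the finite nonempty set 'S_n; the seed value is the
    candidate for the identity permutation) *)
Definition delta2hat (n : nat) (A B : 'M[R]_n) : R :=
  \big[Num.min/mnorm2 (mx_perm A 1%g - B)]_(s : 'S_n) mnorm2 (mx_perm A s - B).

Definition blowup (n k : nat) (pi : 'I_n -> 'I_k) (B : 'M[R]_k) : 'M[R]_n :=
  \matrix_(i, j) B (pi i) (pi j).

Definition classes_ge (n k : nat) (kappa : R) (pi : 'I_n -> 'I_k) : Prop :=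
  forall c : 'I_k, #|[set i | pi i == c]| = 0%N \/
    (Num.floor (kappa * n%:R) <= (#|[set i | pi i == c]|)%:Z)%R.

Definition blockmx_ge (n : nat) (kappa : R) : set 'M[R]_n :=
  [set H | exists (k : nat) (pi : 'I_n -> 'I_k) (B : 'M[R]_k),
             classes_ge kappa pi /\ H = blowup pi B].

(** hat eps^(2)_{>= kappa}(H) = min_{B in A_{n,>=kappa}} ||H - B||_2
    (the minimum is attained; we write it as the infimum) *)
Definition epshat2 (n : nat) (kappa : R) (H : 'M[R]_n) : R :=
  inf [set mnorm2 (H - B) | B in @blockmx_ge n kappa].

Definition ls_k (n : nat) (kappa : R) : nat :=
  `|Num.ceil ((n%:R : R) / ((Num.floor (kappa * n%:R))%:~R : R))|%N.

Definition is_LS_output (n : nat) (kappa : R) (A : 'M[R]_n)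
    (pih : 'I_n -> 'I_(ls_k n kappa)) (Bh : 'M[R]_(ls_k n kappa)) : Prop :=
  classes_ge kappa pih /\
  forall (pi : 'I_n -> 'I_(ls_k n kappa)) (B : 'M[R]_(ls_k n kappa)),
    classes_ge kappa pi -> mnorm2 (A - blowup pih Bh) <= mnorm2 (A - blowup pi B).

Definition is_graphon (d : measure_display) (T : measurableType d)
    (W : T -> T -> R) : Prop :=
  measurable_fun setT (fun z : T * T => W z.1 z.2) /\
  (forall x y, 0 <= W x y) /\ (forall x y, W x y = W y x).

(** Sampling randomness on a probability space (S, P):
    latent points X i (i : nat), i.i.d. with law pi, and uniform U i j
    (i < j), all mutually independent.  Edge {i,j} of G_n is present
    iff U (min i j) (max i j) < Q_ij.  *)
Definition sampling_scheme (d : measure_display) (T : measurableType d)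
    (pi : probability T R)
    (dS : measure_display) (S : measurableType dS) (P : probability S R)
    (X : nat -> S -> T) (U : nat -> nat -> S -> R) : Prop :=
  (forall i, measurable_fun setT (X i)) /\
  (forall i j, (i < j)%N -> measurable_fun setT (U i j)) /\
  (forall i (A : set T), measurable A -> P (X i @^-1` A) = pi A) /\
  (forall i j (B : set R), (i < j)%N -> measurable B ->
      P (U i j @^-1` B) = lebesgue_measure (B `&` `[0, 1]%classic)) /\
  (forall (F : seq nat) (E : seq (nat * nat))
          (A : nat -> set T) (B : nat * nat -> set R),
     uniq F -> uniq E -> all (fun e => (e.1 < e.2)%N) E ->
     (forall i, measurable (A i)) -> (forall e, measurable (B e)) ->
     fine (P (\bigcap_(i in [set` F]) (X i @^-1` A i) `&`
              \bigcap_(e in [set` E]) (U e.1 e.2 @^-1` B e))) =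
     (\prod_(i <- F) fine (P (X i @^-1` A i))) *
     (\prod_(e <- E) fine (P (U e.1 e.2 @^-1` B e)))).

Definition Qmx (T : Type) (W : T -> T -> R) (rho : R) (n : nat)
    (x : nat -> T) : 'M[R]_n :=
  \matrix_(i, j) (if i == j then 0 else Num.min 1 (rho * W (x i) (x j))).

Definition Gadj (T : Type) (W : T -> T -> R) (rho : R) (n : nat)
    (x : nat -> T) (u : nat -> nat -> R) : 'M[R]_n :=
  \matrix_(i, j) (if (i != j) &&
                     (u (minn i j) (maxn i j) < @Qmx T W rho n x i j) then 1 else 0).

Definition rate (rho kappa : R) (n : nat) : R :=
  rho * Num.sqrt (Num.sqrt ((1 + ln (1 / kappa)) / (kappa ^+ 2 * rho * n%:R))).

Definition LS_bound (T : Type) (W : T -> T -> R) (rho kappa : R) (n : nat)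
    (x : nat -> T) (u : nat -> nat -> R) (M : R) : Prop :=
  forall (pih : 'I_n -> 'I_(ls_k n kappa)) (Bh : 'M[R]_(ls_k n kappa)),
    @is_LS_output n kappa (@Gadj T W rho n x u) pih Bh ->
    delta2hat (blowup pih Bh) (@Qmx T W rho n x) <=
      epshat2 kappa (@Qmx T W rho n x) + M * rate rho kappa n.

End Defs.

(* Main.v *)
(** Write [Z] for the difference between the adjacency matrix and [Q], and let
    [m] be the minimal class size.  Comparing the least squares output with a
    competitor [H], the squared errors differ by at most twice the pairing of
    [Z] with block matrices.  The entries of such a matrix [B] are at most
    [n ||B||_2 / m] in absolute value, so its pairing with [Z] is controlled by
    the maximum of [sum_ij s (pi i) (pi j) Z_ij] over all partitions [pi] and
    all sign patterns [s].  Given the latent points, an exponential moment bound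
    and a union bound over the [k^n 2^(k^2)] pairs [(pi, s)] control this
    maximum, as soon as the mean square of [W] over the sampled pairs is
    bounded.  The latter follows from Markov's inequality in the first part; in
    the second part it is a strong law for a U-statistic whose kernel has only a
    first moment, obtained along dyadic sample sizes by truncating the kernel
    and its one-variable marginal, computing a second moment and applying
    Borel-Cantelli. *)

Require Import Defs.
From HB Require Import structures.
From mathcomp Require Import all_boot all_order all_algebra all_fingroup.
From mathcomp Require Import all_classical all_reals all_analysis.
From mathcomp Require Import measurable_realfun ring lra.

Set Implicit Arguments.
Unset Strict Implicit.
Unset Printing Implicit Defensive.

Import Order.TTheory GRing.Theory Num.Theory.
Local Open Scope classical_set_scope.
Local Open Scope ring_scope.

(** * The least squares inequality *)

Section LeastSquares.
Context {R : realType}.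
Implicit Types (n k : nat).

(** The fourth root comes from a quadratic inequality for the error: the noise term [d], of order
    [rho] times a square root, enters it multiplied by [mnorm2 Q], of order [rho], and solving for
    the error takes the root of this product. Solving exactly keeps the coefficient of [epshat2]
    equal to 1. No conditional expectation is formed: the exponent carries its own random
    compensator, a multiple of the sum of the entries of [Q], so its exponential has mean at most 1
    outright. The union bound is likewise a single random variable, a finite sum of exponentials;
    once it is below 1, all the inequalities hold together. In the second part [kappa] acts on this
    sum only through the number of classes, at most [n], so summing over these numbers serves all
    [kappa] simultaneously. The marginal is truncated along with the kernel because pairs sharing
    one index contribute the square of the marginal to the variance of a U-statistic, and this
    square need not be integrable. *)

Lemma sum_block n k (pi : 'I_n -> 'I_k) (F : 'I_k -> 'I_k -> R) (Z : 'M[R]_n) :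
  \sum_i \sum_j F (pi i) (pi j) * Z i j =
  \sum_a \sum_b F a b * (\sum_(i | pi i == a) \sum_(j | pi j == b) Z i j).
Proof.
rewrite (partition_big pi predT)//=; apply: eq_bigr => a _.
rewrite (eq_bigr (fun i => \sum_b \sum_(j | pi j == b) F a b * Z i j)).
  rewrite exchange_big/=; apply: eq_bigr => b _.
  by rewrite mulr_sumr; apply: eq_bigr => i _; rewrite mulr_sumr.
move=> i /eqP <-; rewrite (partition_big pi predT)//=.
by apply: eq_bigr => b _; apply: eq_bigr => j /eqP ->.
Qed.

(** An entry of the blow-up is repeated over a block with at least [m] rows and [m] columns, so its
    square is counted at least [m ^ 2] times. *)
Lemma blowup_entry_le n k m (pi : 'I_n -> 'I_k) (B : 'M[R]_k) i j :
  (forall c, #|[pred i | pi i == c]| = 0%N \/ (m <= #|[pred i | pi i == c]|)%N) ->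
  m%:R * `|blowup pi B i j| <=
    Num.sqrt (\sum_i \sum_j (blowup pi B i j) ^+ 2).
Proof.
move=> hm.
have cge i0 : (m <= #|[pred i' | pi i' == pi i0]|)%N.
  have [/card0_eq/(_ i0)|//] := hm (pi i0).
  by rewrite !inE eqxx.
rewrite -ler_sqr ?nnegrE ?mulr_ge0 ?sqrtr_ge0//.
rewrite sqr_sqrtr; last by do 2 (apply: sumr_ge0 => ? _); exact: sqr_ge0.
rewrite exprMn real_normK ?num_real// mxE.
set b := B _ _ ^+ 2; have b0 : 0 <= b by exact: sqr_ge0.
apply: (@le_trans _ _ (\sum_(i' | pi i' == pi i) \sum_(j' | pi j' == pi j) b)).
  rewrite [X in _ <= X](eq_bigr (fun=> b *+ #|[pred j' | pi j' == pi j]|)).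
    2:{ by move=> i' _; rewrite sumr_const. }
  rewrite sumr_const -mulrnA -[leRHS]mulr_natl.
  rewrite ler_wpM2r// -natrX ler_nat -mulnn.
  by apply: leq_mul; exact: cge.
rewrite [leRHS](bigID (fun i' => pi i' == pi i))/= -[leLHS]addr0 lerD//; last first.
  by do 2 (apply: sumr_ge0 => ? _); exact: sqr_ge0.
apply: ler_sum => i' /eqP ei.
rewrite [leRHS](bigID (fun j' => pi j' == pi j))/= -[leLHS]addr0 lerD//.
  by apply: ler_sum => j' /eqP ej; rewrite mxE ei ej.
by apply: sumr_ge0 => ? _; exact: sqr_ge0.
Qed.

(** With the entries of [B] bounded, the worst case is the sum of the absolute values of the block
    sums of [Z]. Taking for [s] the signs of these block sums turns it into one of the sums bounded
    by [D]. *)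
Lemma blowup_pairing_le n k m (pi : 'I_n -> 'I_k) (B : 'M[R]_k) (Z : 'M[R]_n) (D : R) :
  (0 < m)%N ->
  (forall c, #|[pred i | pi i == c]| = 0%N \/ (m <= #|[pred i | pi i == c]|)%N) ->
  (forall s : 'I_k -> 'I_k -> bool,
     \sum_i \sum_j (-1) ^+ s (pi i) (pi j) * Z i j <= D) ->
  `|\sum_i \sum_j blowup pi B i j * Z i j| <=
     Num.sqrt (\sum_i \sum_j (blowup pi B i j) ^+ 2) / m%:R * D.
Proof.
move=> m0 hm hD; set N := Num.sqrt _.
have mR : 0 < m%:R :> R by rewrite ltr0n.
pose Zb a b := \sum_(i | pi i == a) \sum_(j | pi j == b) Z i j.
have -> : \sum_i \sum_j blowup pi B i j * Z i j = \sum_a \sum_b B a b * Zb a b.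
  rewrite -sum_block; apply: eq_bigr => i _; apply: eq_bigr => j _.
  by rewrite mxE.
apply: (@le_trans _ _ (\sum_a \sum_b (N / m%:R) * `|Zb a b|)).
  apply: le_trans (ler_norm_sum _ _ _) _; apply: ler_sum => a _.
  apply: le_trans (ler_norm_sum _ _ _) _; apply: ler_sum => b _.
  rewrite normrM.
  (* Nothing bounds [B] at the index of an empty class, but there the block sum of [Z] vanishes. *)
  have [/existsP[i /eqP <-]|/existsPn na] := boolP [exists i, pi i == a]; last first.
    by rewrite /Zb big1 ?normr0 ?mulr0// => i; rewrite (negbTE (na i)).
  have [/existsP[j /eqP <-]|/existsPn nb] := boolP [exists j, pi j == b]; last first.
    rewrite /Zb big1 ?normr0 ?mulr0// => i' _.
    by rewrite big1// => j; rewrite (negbTE (nb j)).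
  rewrite ler_wpM2r// ler_pdivlMr// mulrC.
  by have := blowup_entry_le B i j hm; rewrite mxE.
rewrite (eq_bigr (fun a => N / m%:R * \sum_b (-1) ^+ (Zb a b < 0)%R * Zb a b)).
  2:{ by move=> a _; rewrite mulr_sumr; apply: eq_bigr => b _; rewrite normrEsign. }
rewrite -mulr_sumr ler_wpM2l ?divr_ge0 ?sqrtr_ge0//.
by rewrite -sum_block; exact: (hD (fun a b => (Zb a b < 0)%R)).
Qed.

Lemma classes_geE n k m (kappa : R) (pi : 'I_n -> 'I_k) :
  Num.floor (kappa * n%:R) = m%:Z ->
  classes_ge kappa pi <->
  forall c, #|[pred i | pi i == c]| = 0%N \/ (m <= #|[pred i | pi i == c]|)%N.
Proof.
move=> hm; rewrite /classes_ge hm.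
have cE c : #|[set i | pi i == c]%classic| = #|[pred i | pi i == c]|.
  by apply: eq_card => i; rewrite !inE; apply/idP/idP => [/asboolP|?]//; apply/asboolP.
by split => h c; have := h c; rewrite cE lez_nat.
Qed.

(** Competitors in [epshat2] may use any number of labels, the algorithm only [k]. At most [n / m]
    classes are non-empty, which is at most [k], so each label can be replaced by its position in
    the list of labels in use. *)
Lemma blockmx_ge_relabel n k m (kappa : R) (H : 'M[R]_n) :
  Num.floor (kappa * n%:R) = m%:Z -> (0 < m)%N -> (0 < n)%N -> (n <= k * m)%N ->
  blockmx_ge kappa H ->
  exists (pi : 'I_n -> 'I_k) (B : 'M[R]_k),
    classes_ge kappa pi /\ H = blowup pi B.
Proof.
move=> hm m0 n0 nkm [k' [pi [B [/(classes_geE pi hm) cl ->]]]].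
pose s := undup (codom pi).
have us : uniq s by exact: undup_uniq.
have ms i : pi i \in s by rewrite mem_undup codom_f.
have cge c : c \in s -> (m <= #|[pred i | pi i == c]|)%N.
  rewrite mem_undup => /codomP[i ->].
  by have [/card0_eq/(_ i)|//] := cl (pi i); rewrite !inE eqxx.
have sk : (size s <= k)%N.
  rewrite -(leq_pmul2r m0); apply: leq_trans nkm.
  have -> : (size s * m = \sum_(c <- s) m)%N by rewrite big_const_seq iter_addn_0 count_predT mulnC.
  have -> : (n = \sum_(c <- s) #|[pred i | pi i == c]|)%N.
    rewrite -{1}(card_ord n) -sum1_card (partition_big pi (mem s))//=.
    rewrite -big_uniq//=; apply: eq_bigr => c _.
    by rewrite sum1_card; apply: eq_card => i; rewrite !inE.
  by rewrite big_seq [leqRHS]big_seq; apply: leq_sum => c; exact: cge.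
have ltk i : (index (pi i) s < k)%N by rewrite (leq_trans _ sk)// index_mem.
pose x0 := pi (Ordinal n0).
exists (fun i => Ordinal (ltk i)), (\matrix_(a, b) B (nth x0 s a) (nth x0 s b)).
split; last by apply/matrixP => i j; rewrite !mxE/= !nth_index.
apply/(classes_geE _ hm) => c.
have [cs|sc] := ltnP c (size s); last first.
  left; apply: eq_card0 => i; rewrite !inE; apply/negP => /eqP/(congr1 val)/= e.
  by move: sc; rewrite -e leqNgt index_mem ms.
right; apply: leq_trans (cge (nth x0 s c) (mem_nth _ cs)) _.
apply: subset_leq_card; apply/fintype.subsetP => i; rewrite !inE => /eqP e.
by apply/eqP/val_inj; rewrite /= e index_uniq.
Qed.

Lemma mnorm2_sqr n (A : 'M[R]_n) :
  mnorm2 A ^+ 2 = (n%:R ^+ 2)^-1 * \sum_i \sum_j (A i j) ^+ 2.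
Proof.
rewrite sqr_sqrtr// mulr_ge0 ?invr_ge0 ?exprn_ge0//.
by do 2 (apply: sumr_ge0 => ? _); exact: sqr_ge0.
Qed.

Lemma mnorm2_ge0 n (A : 'M[R]_n) : 0 <= mnorm2 A.
Proof. exact: sqrtr_ge0. Qed.

Lemma mnorm2B n (A B : 'M[R]_n) : mnorm2 (A - B) = mnorm2 (B - A).
Proof.
congr (Num.sqrt (_ * _)); apply: eq_bigr => i _; apply: eq_bigr => j _.
by rewrite !mxE; ring.
Qed.

(** A lossy triangle inequality, read off entrywise from [2 Q^2 + 2 (Q - H)^2 - H^2 = (2 Q - H)^2];
    the factor 2 only affects constants. *)
Lemma mnorm2_le_subadd n (Q H : 'M[R]_n) :
  mnorm2 H <= 2 * (mnorm2 Q + mnorm2 (Q - H)).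
Proof.
rewrite -ler_sqr ?nnegrE ?mulr_ge0 ?addr_ge0 ?mnorm2_ge0//.
apply: (@le_trans _ _ (2 * mnorm2 Q ^+ 2 + 2 * mnorm2 (Q - H) ^+ 2)).
  rewrite !mnorm2_sqr ![2 * (_ * _)]mulrCA -mulrDr ler_wpM2l ?invr_ge0 ?exprn_ge0//.
  rewrite !mulr_sumr -big_split/=; apply: ler_sum => i _.
  rewrite !mulr_sumr -big_split/=; apply: ler_sum => j _.
  rewrite !mxE -subr_ge0.
  by rewrite [leRHS](_ : _ = (2 * Q i j - H i j) ^+ 2) ?sqr_ge0//; ring.
move: (mnorm2 Q) (mnorm2 (Q - H)) (mnorm2_ge0 Q) (mnorm2_ge0 (Q - H)) => q e q0 e0.
have : 0 <= q * e by rewrite mulr_ge0.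
nra.
Qed.

(** The first and third terms are free of [H] and cancel when two candidates are compared. *)
Lemma mnorm2B_expand n (A Q H : 'M[R]_n) :
  mnorm2 (A - H) ^+ 2 = mnorm2 (A - Q) ^+ 2 + mnorm2 (Q - H) ^+ 2 +
   2 * (n%:R ^+ 2)^-1 * (\sum_i \sum_j Q i j * (A - Q) i j)
   - 2 * (n%:R ^+ 2)^-1 * (\sum_i \sum_j H i j * (A - Q) i j).
Proof.
rewrite !mnorm2_sqr; set c := _^-1.
suff -> : \sum_i \sum_j (A - H) i j ^+ 2 = \sum_i \sum_j (A - Q) i j ^+ 2 +
    \sum_i \sum_j (Q - H) i j ^+ 2 + 2 * (\sum_i \sum_j Q i j * (A - Q) i j) -
    2 * (\sum_i \sum_j H i j * (A - Q) i j) by ring.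
rewrite !mulr_sumr -!big_split/= -sumrB; apply: eq_bigr => i _.
rewrite !mulr_sumr -!big_split/= -sumrB; apply: eq_bigr => j _.
by rewrite !mxE; ring.
Qed.

(** The hypothesis says [(y - e - 4 d) (y + e) <= 8 d q]; if the conclusion failed, both factors
    would exceed the root of the right-hand side. *)
Lemma le_root_quadratic (y e q d : R) : 0 <= y -> 0 <= e -> 0 <= q -> 0 <= d ->
  y ^+ 2 <= e ^+ 2 + 4 * d * (2 * q + y + e) ->
  y <= e + (4 * d + Num.sqrt (8 * d * q)).
Proof.
move=> y0 e0 q0 d0 h; rewrite leNgt; apply/negP => hlt.
have s0 := sqrtr_ge0 (8 * d * q).
have ss : Num.sqrt (8 * d * q) ^+ 2 = 8 * d * q by rewrite sqr_sqrtr ?mulr_ge0.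
set s := Num.sqrt _ in hlt s0 ss.
have h1 : (y - e - 4 * d) * (y + e) <= s ^+ 2 by rewrite ss; nra.
have h2 : s < y - e - 4 * d by lra.
have h3 : s < y + e by lra.
have : s * s < (y - e - 4 * d) * (y + e) by rewrite ltr_pM.
by rewrite -expr2 ltNge h1.
Qed.

Lemma LS_oracle n m (kappa : R) (A Q : 'M[R]_n) (D : R)
    (pih : 'I_n -> 'I_(ls_k n kappa)) (Bh : 'M[R]_(ls_k n kappa)) (H : 'M[R]_n) :
  Num.floor (kappa * n%:R) = m%:Z -> (0 < m)%N -> (0 < n)%N ->
  (n <= ls_k n kappa * m)%N ->
  (forall (pi : 'I_n -> 'I_(ls_k n kappa)) (s : 'I__ -> 'I__ -> bool),
    \sum_i \sum_j (-1) ^+ s (pi i) (pi j) * (A - Q) i j <= D) ->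
  is_LS_output A pih Bh -> blockmx_ge kappa H ->
  mnorm2 (blowup pih Bh - Q) <= mnorm2 (Q - H) +
    (4 * (D / (n%:R * m%:R)) + Num.sqrt (8 * (D / (n%:R * m%:R)) * mnorm2 Q)).
Proof.
move=> hm m0 n0 nkm hD [clh minh] hH; set d := D / _.
have nR : 0 < n%:R :> R by rewrite ltr0n.
have mR : 0 < m%:R :> R by rewrite ltr0n.
(* The two constant sign patterns give opposite sums, both at most [D]. *)
have D0 : 0 <= D.
  have h s := hD pih (fun _ _ => s).
  have := lerD (h true) (h false); rewrite -big_split/= big1; first by lra.
  by move=> i _; rewrite -big_split big1//= => j _; ring.
have d0 : 0 <= d by rewrite divr_ge0 ?mulr_ge0.
have pairing (pi : 'I_n -> 'I_(ls_k n kappa)) (B : 'M[R]_(ls_k n kappa)) : classes_ge kappa pi ->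
    `|(n%:R ^+ 2)^-1 * \sum_i \sum_j blowup pi B i j * (A - Q) i j| <=
    d * mnorm2 (blowup pi B).
  move=> /(classes_geE _ hm) cl.
  have := blowup_pairing_le B m0 cl (hD pi).
  rewrite normrM ger0_norm ?invr_ge0 ?exprn_ge0//.
  rewrite /mnorm2 sqrtrM ?invr_ge0 ?exprn_ge0// -exprVn sqrtr_sqr (@ger0_norm _ n%:R^-1) ?invr_ge0//.
  set N := Num.sqrt _; set S := `|_| => le_S.
  apply: (@le_trans _ _ (n%:R^-1 ^+ 2 * (N / m%:R * D))).
    by rewrite ler_wpM2l ?exprn_ge0 ?invr_ge0.
  rewrite le_eqVlt; apply/orP; left; apply/eqP; rewrite /d.
  by field; rewrite !gt_eqF.
clearbody d.
have [pi [B [cl ->]]] := blockmx_ge_relabel hm m0 n0 nkm hH.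
(* Each of the two pairings costs [2 d] times the norm of a block matrix, itself at most twice
   [mnorm2 Q] plus its distance to [Q]; together this is the term [4 d (2 q + y + e)]. *)
rewrite mnorm2B; apply: le_root_quadratic; rewrite ?mnorm2_ge0//.
have := minh pi B cl; rewrite -ler_sqr ?nnegrE ?mnorm2_ge0//.
rewrite (mnorm2B_expand A Q) (mnorm2B_expand A Q (blowup pi B)) -!mulrA.
have := le_trans (pairing pih Bh clh) (ler_wpM2l d0 (mnorm2_le_subadd Q _)).
have := le_trans (pairing pi B cl) (ler_wpM2l d0 (mnorm2_le_subadd Q _)).
rewrite !ler_norml => /andP[+ _] /andP[_ +].
move: (mnorm2 (Q - _)) (mnorm2 (Q - _)) (mnorm2 (A - Q)) (mnorm2 Q).
move: (_^-1 * _) (_^-1 * _) (_^-1 * _) => a1 a2 a3 y e z q.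
by move=> h1 h2 h3; lra.
Qed.

End LeastSquares.

(** * Constants and the deterministic bound *)

Section RateConstants.
Context {R : realType}.

(** Chosen to keep [ls_theta] at most 1/4, the range of the exponential moment bound: the square
    root in [ls_theta] will be at most [2 sqrt C]. *)
Definition ls_eta (C : R) : R := (8 * (Num.sqrt C + 1))^-1.

(* The exponential-moment parameter balancing the variance term against the
   entropy of the partitions into k classes. *)
Definition ls_theta (C rho : R) (n k : nat) : R :=
  ls_eta C * Num.sqrt ((1 + ln k%:R) / (rho * n%:R)).

(** The last two terms dominate the logarithm of the number [k^n 2^(k^2)] of pairs of a partition
    and a sign pattern; the first leaves a failure probability [exp (- a n)]. *)
Definition ls_entropy (a : R) (n k : nat) : R :=
  a * n%:R + n%:R * ln k%:R + k%:R ^+ 2.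

(** What remains after dividing the deviation inequality by [ls_theta]: the first summand comes from
    the compensator, the second from the entropy, where [9 * C] stems from
    [k^2 <= 9 / kappa^2 <= 9 C n]. *)
Definition ls_const0 (C a V : R) : R :=
  4 * ls_eta C * (1 + V) + (a + 1 + 9 * C) / ls_eta C.

(** The two summands absorb the linear term and the square root term of [LS_oracle], in this
    order. *)
Definition ls_const (C a V : R) : R :=
  24 * ls_const0 C a V * Num.sqrt (Num.sqrt C) +
  Num.sqrt (48 * ls_const0 C a V * Num.sqrt V).

Lemma ls_eta_gt0 C : 0 < ls_eta C.
Proof. by rewrite invr_gt0 mulr_gt0// ltr_wpDl ?sqrtr_ge0. Qed.

Lemma ls_theta_ge0 C rho n k : 0 <= ls_theta C rho n k.
Proof. by rewrite mulr_ge0 ?sqrtr_ge0// ltW// ls_eta_gt0. Qed.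

(** The number of classes is comparable to [1 / kappa]. Rounding costs the factor 3: [(k - 1) m < n]
    and [kappa n < m + 1 <= 2 m] give [(k - 1) kappa <= 2]. *)
Lemma ls_k_bounds (n : nat) (kappa : R) : 0 < kappa <= 1 -> 1 < n%:R * kappa ->
  exists m : nat, [/\ Num.floor (kappa * n%:R) = m%:Z, (0 < m)%N,
    (n <= ls_k n kappa * m)%N & [/\ (ls_k n kappa <= n)%N,
    1 <= (ls_k n kappa)%:R * kappa & (ls_k n kappa)%:R * kappa <= 3]].
Proof.
move=> /andP[k0 k1] nk.
have n0 : 0 < n%:R :> R.
  by rewrite lt0r ler0n andbT; apply: contraTneq nk => ->; rewrite mul0r -leNgt.
have f1 : (1 <= Num.floor (kappa * n%:R))%R.
  by rewrite floor_ge_int mulrC ltW.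
case E : (Num.floor (kappa * n%:R)) f1 => [m|//]; rewrite lez_nat => m0.
have mR : 0 < m%:R :> R by rewrite ltr0n.
have mle : m%:R <= kappa * n%:R by have := floor_le (kappa * n%:R); rewrite E.
have mgt : kappa * n%:R < m%:R + 1.
  by have := floorD1_gt (kappa * n%:R); rewrite E intrD.
have kE : (ls_k n kappa)%:R = (Num.ceil (n%:R / m%:R : R))%:~R :> R.
  rewrite /ls_k E natr_absz ger0_norm// ceil_ge0.
  by apply: lt_trans (_ : 0 < _); rewrite ?ltrN10// divr_gt0.
have nm : n%:R <= (ls_k n kappa)%:R * m%:R :> R.
  by rewrite kE -ler_pdivrMr// ceil_ge.
exists m; split => //; first by rewrite -(ler_nat R) natrM.
split.
- rewrite -(ler_nat R) kE -[n%:R]/((n%:Z)%:~R) ler_int ceil_le_int.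
  by rewrite ler_pdivrMr// ler_peMr ?ler1n// ltW.
- rewrite -(ler_pM2r n0) mul1r (le_trans nm)// -mulrA ler_wpM2l//.
- have : (ls_k n kappa)%:R - 1 < n%:R / m%:R :> R.
    by have := ceilB1_lt (n%:R / m%:R : R); rewrite kE intrB.
  rewrite ltr_pdivlMr// => h.
  have m1 : 1 <= m%:R :> R by rewrite ler1n.
  have h1 : kappa * ((ls_k n kappa)%:R - 1) * m%:R <= 2 * m%:R.
    by rewrite -mulrA (le_trans (ler_wpM2l (ltW k0) (ltW h)))//; lra.
  by move: h1; rewrite ler_pM2r//; lra.
Qed.

Lemma ln_le_subr1 (x : R) : 0 < x -> ln x <= x - 1.
Proof. by move=> x0; have := @le_ln1Dx R (x - 1); rewrite addrCA subrr addr0; apply; lra. Qed.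

Lemma ls_log_le (n : nat) (kappa : R) : 0 < kappa <= 1 -> 1 < n%:R * kappa ->
  0 < 1 + ln (ls_k n kappa)%:R :> R /\
  1 + ln (ls_k n kappa)%:R <= 4 * (1 + ln (1 / kappa)).
Proof.
move=> kp nk; have [m [_ _ _ [_ h1 h3]]] := ls_k_bounds kp nk.
case/andP: kp => k0 k1.
set k := ls_k n kappa in h1 h3 *.
have kR : 1 <= k%:R :> R.
  by apply: le_trans h1 _; rewrite ler_piMr.
have lk : 0 <= ln k%:R :> R by rewrite ln_ge0.
have lk0 : 0 <= ln (1 / kappa) by rewrite ln_ge0// ler_pdivlMr// mul1r.
split; first by lra.
have : ln k%:R <= ln (3 * (1 / kappa)).
  rewrite ler_ln ?posrE ?mulr_gt0 ?invr_gt0//; last lra.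
  by rewrite mul1r ler_pdivlMr.
rewrite lnM ?posrE ?mulr_gt0 ?invr_gt0//.
have := @ln_le_subr1 3; lra.
Qed.

Lemma ls_theta_le C rho (n : nat) (kappa : R) : 0 < C -> 0 < rho <= 1 ->
  0 < kappa <= 1 -> 1 < n%:R * kappa ->
  (1 + ln (1 / kappa)) / kappa ^+ 2 <= C * (rho * n%:R) ->
  0 < ls_theta C rho n (ls_k n kappa) <= 4^-1.
Proof.
move=> C0 /andP[r0 r1] kp nk hC.
have [L0 L1] := ls_log_le kp nk.
case/andP: kp => k0 k1.
have n0 : 0 < n%:R :> R by rewrite lt0r ler0n andbT; apply: contraTneq nk => ->; rewrite mul0r -leNgt.
have rn : 0 < rho * n%:R by rewrite mulr_gt0.
have e0 := ls_eta_gt0 C.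
apply/andP; split; first by rewrite mulr_gt0// sqrtr_gt0 divr_gt0.
have L2 : 1 + ln (1 / kappa) <= C * (rho * n%:R).
  apply: le_trans hC; rewrite ler_pdivlMr ?exprn_gt0// ler_piMr//; first by lra.
  by rewrite exprn_ile1// ltW.
have : Num.sqrt ((1 + ln (ls_k n kappa)%:R) / (rho * n%:R)) <= 2 * Num.sqrt C.
  rewrite -[2 * _]ger0_norm ?mulr_ge0 ?sqrtr_ge0// -sqrtr_sqr ler_wsqrtr//.
  rewrite exprMn sqr_sqrtr ?(ltW C0)// ler_pdivrMr// (le_trans L1)//.
  lra.
have sC := sqrtr_ge0 C.
rewrite /ls_theta /ls_eta => h.
by rewrite ler_pdivrMl; lra.
Qed.

(** The deterministic half shared by both parts: only the last two hypotheses concern the sample,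
    and each part provides them on its own event. *)
Lemma LS_bound_of_deviation (T : Type) (W : T -> T -> R) (C a V rho kappa : R)
    (n : nat) (x : nat -> T) (u : nat -> nat -> R) :
  0 < C -> 0 <= a -> 0 <= V -> (forall y z, 0 <= W y z) ->
  0 < rho <= 1 -> 0 < kappa <= 1 -> 1 < n%:R * kappa ->
  (1 + ln (1 / kappa)) / kappa ^+ 2 <= C * (rho * n%:R) ->
  \sum_(i < n) \sum_(j < n | i != j) W (x i) (x j) ^+ 2 <= V * n%:R ^+ 2 ->
  (forall (pi : 'I_n -> 'I_(ls_k n kappa)) (s : 'I__ -> 'I__ -> bool),
    ls_theta C rho n (ls_k n kappa) * (\sum_i \sum_j (-1) ^+ s (pi i) (pi j) *
        (Gadj W rho n x u - Qmx W rho n x) i j) <=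
    4 * ls_theta C rho n (ls_k n kappa) ^+ 2 * (\sum_i \sum_j Qmx W rho n x i j)
      + ls_entropy a n (ls_k n kappa)) ->
  LS_bound W rho kappa n x u (ls_const C a V).
Proof.
move=> C0 a0 V0 W0 rp kp nk hC hV hdev pih Bh hLS.
have /andP[t0 _] := ls_theta_le C0 rp kp nk hC.
have [L0 L1] := ls_log_le kp nk.
have [m [hm m0 nkm [kn k1 k3]]] := ls_k_bounds kp nk.
case/andP: kp rp => ka0 ka1 /andP[r0 r1].
have nR : 0 < n%:R :> R by rewrite lt0r ler0n andbT; apply: contraTneq nk => ->; rewrite mul0r -leNgt.
have n0 : (0 < n)%N by rewrite -(ltr0n R).
have mR : 0 < m%:R :> R by rewrite ltr0n.
have e0 := ls_eta_gt0 C.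
have rn : 0 < rho * n%:R by rewrite mulr_gt0.
set Q := Qmx W rho n x in hdev *.
have Qge0 i j : 0 <= Q i j.
  rewrite mxE; case: ifP => // _.
  by rewrite le_min ler01 mulr_ge0// ltW.
(* An off-diagonal entry is at most [rho W], and [W <= 1 + W^2], so the mean square also controls
   the sum of the edge probabilities. *)
have sumQ : \sum_i \sum_j Q i j <= rho * n%:R ^+ 2 * (1 + V).
  have -> : rho * n%:R ^+ 2 * (1 + V) = rho * (n%:R ^+ 2 + V * n%:R ^+ 2) by ring.
  apply: le_trans (ler_wpM2l (ltW r0) (_ : \sum_(i < n) \sum_(j < n)
    (1 + (if i != j then W (x i) (x j) ^+ 2 else 0)) <= _)).
    rewrite mulr_sumr; apply: ler_sum => i _; rewrite mulr_sumr; apply: ler_sum => j _.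
    rewrite mxE; case: eqP => _ /=; first by rewrite addr0 mulr1 ltW.
    rewrite ge_min; apply/orP; right; rewrite ler_pM2l//.
    by have := sqr_ge0 (W (x i) (x j) - 1); have := W0 (x i) (x j); nra.
  rewrite (eq_bigr (fun i => n%:R + \sum_(j < n | i != j) W (x i) (x j) ^+ 2)).
    by rewrite big_split/= sumr_const card_ord -[n%:R *+ n]mulr_natr -expr2 lerD2l.
  by move=> i _; rewrite big_split/= sumr_const card_ord -big_mkcond.
have normQ : mnorm2 Q <= rho * Num.sqrt V.
  rewrite -ler_sqr ?nnegrE ?mnorm2_ge0 ?mulr_ge0 ?sqrtr_ge0 ?(ltW r0)//.
  rewrite mnorm2_sqr exprMn sqr_sqrtr// ler_pdivrMl ?exprn_gt0//.
  have -> : n%:R ^+ 2 * (rho ^+ 2 * V) = rho ^+ 2 * (V * n%:R ^+ 2) by ring.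
  apply: le_trans (ler_wpM2l (sqr_ge0 rho) hV).
  rewrite mulr_sumr; apply: ler_sum => i _; rewrite [X in _ * X]big_mkcond mulr_sumr.
  apply: ler_sum => j _; rewrite mxE; case: eqP => _ /=; first by rewrite expr0n/= mulr0.
  rewrite -exprMn ler_sqr ?nnegrE ?ge_min ?lexx ?orbT//.
    by rewrite le_min ler01 mulr_ge0// ltW.
  by rewrite mulr_ge0// ltW.
set k := ls_k n kappa in pih Bh hLS hdev t0 L0 L1 nkm kn k1 k3 *.
set r := Num.sqrt ((1 + ln k%:R) / (rho * n%:R)).
have r2 : r ^+ 2 = (1 + ln k%:R) / (rho * n%:R) by rewrite sqr_sqrtr// ltW// divr_gt0.
have rgt0 : 0 < r by rewrite sqrtr_gt0 divr_gt0.
set c := ls_const0 C a V.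
have c0 : 0 <= c.
  rewrite addr_ge0// ?divr_ge0 ?mulr_ge0 ?addr_ge0 ?mulr_ge0//; exact: ltW.
have entr : ls_entropy a n k <= (a + 1 + 9 * C) * n%:R * (1 + ln k%:R).
  have kR : 1 <= k%:R :> R by apply: le_trans k1 _; rewrite ler_piMr.
  have lk : 0 <= ln k%:R :> R by rewrite ln_ge0.
  have lk0 : 0 <= ln (1 / kappa) by rewrite ln_ge0// ler_pdivlMr// mul1r.
  have kap : (kappa ^+ 2)^-1 <= C * n%:R.
    apply: (@le_trans _ _ (C * (rho * n%:R))).
      apply: le_trans hC; rewrite ler_peMl ?invr_ge0 ?exprn_ge0 ?(ltW ka0)//.
      by rewrite lerDl.
    by rewrite ler_pM2l// ler_piMl// ltW.
  have k2 : k%:R ^+ 2 <= 9 * (C * n%:R).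
    apply: (@le_trans _ _ (9 * (kappa ^+ 2)^-1)); last by rewrite ler_pM2l.
    rewrite ler_pdivlMr ?exprn_gt0// -exprMn.
    have -> : 9 = 3 ^+ 2 :> R by ring.
    by rewrite ler_sqr ?nnegrE// mulr_ge0// ltW.
  have l1 : 0 <= (a + 9 * C) * (n%:R * ln k%:R) by rewrite !mulr_ge0// ?addr_ge0 ?mulr_ge0// ltW.
  rewrite /ls_entropy; move: (n%:R) (ln _) (k%:R ^+ 2) k2 l1 nR => N l K; clear; nra.
(* As [ls_theta] is [ls_eta C * r], the compensator and the entropy are both multiples of
   [rho n^2 r^2]; dividing by [ls_theta] leaves one factor [r]. *)
pose D := c * rho * n%:R ^+ 2 * r.
have hD (pi : 'I_n -> 'I_k) (s : 'I_k -> 'I_k -> bool) :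
    \sum_i \sum_j (-1) ^+ s (pi i) (pi j) * (Gadj W rho n x u - Q) i j <= D.
  rewrite -(ler_pM2l t0); apply: le_trans (hdev pi s) _.
  apply: (@le_trans _ _ (4 * ls_theta C rho n k ^+ 2 * (rho * n%:R ^+ 2 * (1 + V)) +
      (a + 1 + 9 * C) * n%:R * (1 + ln k%:R))).
    by rewrite lerD// ler_wpM2l// mulr_ge0// sqr_ge0.
  have -> : 1 + ln k%:R = r ^+ 2 * (rho * n%:R).
    by rewrite r2 divfK// gt_eqF.
  rewrite /D /ls_theta -/r /c /ls_const0 le_eqVlt; apply/orP; left; apply/eqP.
  by field; rewrite gt_eqF.
set X := (1 + ln (1 / kappa)) / (kappa ^+ 2 * rho * n%:R).
have X0 : 0 <= X.
  by rewrite divr_ge0// ?mulr_ge0 ?exprn_ge0 ?ltW//; lra.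
(* The 6 is 3 times 2, from [k kappa <= 3] and from the square root of
   [1 + ln k <= 4 (1 + ln (1 / kappa))]. *)
have kr : k%:R * r <= 6 * Num.sqrt X.
  rewrite -ler_sqr ?nnegrE ?mulr_ge0 ?sqrtr_ge0// !exprMn r2 sqr_sqrtr//.
  have -> : 6 ^+ 2 * X = 9 * (kappa ^+ 2)^-1 * (4 * (1 + ln (1 / kappa)) / (rho * n%:R)).
    by rewrite /X; field; rewrite !gt_eqF.
  apply: ler_pM; rewrite ?exprn_ge0 ?divr_ge0 ?(ltW L0) ?(ltW rn)//.
    rewrite ler_pdivlMr ?exprn_gt0// -exprMn.
    have -> : 9 = 3 ^+ 2 :> R by ring.
    by rewrite ler_sqr ?nnegrE// mulr_ge0// ltW.
  by rewrite ler_pM2r ?invr_gt0.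
(* The hypothesis on [kappa] says [X <= C]; hence the linear error, of order [sqrt X], is dominated
   by the fourth root. *)
have XC : Num.sqrt X <= Num.sqrt (Num.sqrt X) * Num.sqrt (Num.sqrt C).
  have XC : Num.sqrt X <= Num.sqrt C.
    rewrite ler_wsqrtr//; have -> : X = (1 + ln (1 / kappa)) / kappa ^+ 2 / (rho * n%:R).
      by rewrite /X; field; rewrite !gt_eqF.
    by rewrite ler_pdivrMr.
  rewrite -{1}[Num.sqrt X]sqr_sqrtr ?sqrtr_ge0// expr2.
  by rewrite ler_wpM2l ?sqrtr_ge0// ler_wsqrtr.
set d := D / (n%:R * m%:R).
have d0 : 0 <= d.
  by rewrite /d /D divr_ge0 ?mulr_ge0 ?exprn_ge0 ?(ltW r0) ?(ltW rgt0).
have dle : d <= 6 * c * rho * Num.sqrt X.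
  have -> : 6 * c * rho * Num.sqrt X = c * rho * (6 * Num.sqrt X) by ring.
  have -> : d = c * rho * ((n%:R / m%:R) * r) by rewrite /d /D; field; rewrite !gt_eqF.
  rewrite ler_wpM2l ?mulr_ge0 ?(ltW r0)//; apply: le_trans kr.
  by rewrite ler_pM2r// ler_pdivrMr// -natrM ler_nat.
have errle : 4 * d + Num.sqrt (8 * d * mnorm2 Q) <= ls_const C a V * rate rho kappa n.
  rewrite /ls_const /rate -/X -/c [leRHS]mulrDl; apply: lerD.
    apply: (@le_trans _ _ (24 * c * rho * Num.sqrt X)); first by lra.
    have -> : 24 * c * Num.sqrt (Num.sqrt C) * (rho * Num.sqrt (Num.sqrt X)) =
      24 * c * rho * (Num.sqrt (Num.sqrt X) * Num.sqrt (Num.sqrt C)) by ring.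
    by rewrite ler_wpM2l// !mulr_ge0// (ltW r0).
  apply: (@le_trans _ _ (Num.sqrt (48 * c * Num.sqrt V * (rho ^+ 2 * Num.sqrt X)))).
    rewrite ler_wsqrtr//.
    have -> : 48 * c * Num.sqrt V * (rho ^+ 2 * Num.sqrt X) =
      8 * (6 * c * rho * Num.sqrt X) * (rho * Num.sqrt V) by ring.
    apply: ler_pM => //; [exact: mulr_ge0|exact: mnorm2_ge0|exact: ler_wpM2l].
  rewrite sqrtrM ?mulr_ge0 ?sqrtr_ge0// (@sqrtrM _ (rho ^+ 2)) ?sqr_ge0//.
  by rewrite sqrtr_sqr (@ger0_norm _ rho)// ltW.
(* The bound is proved against each competitor [H]; the output itself shows that the infimum is over
   a non-empty set. *)
rewrite -lerBlDr; apply: lb_le_inf.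
  exists (mnorm2 (Q - blowup pih Bh)); exists (blowup pih Bh) => //.
  by exists k, pih, Bh; split => //; case: hLS.
move=> _ [H hH <-]; rewrite lerBlDr.
(* The output is indexed by the same vertices as [Q], so the identity permutation suffices. *)
apply: (@le_trans _ _ (mnorm2 (blowup pih Bh - Q))).
  rewrite /delta2hat (le_trans (bigmin_le_id _ _ _ _))//.
  suff -> : mx_perm (blowup pih Bh) 1%g = blowup pih Bh by [].
  by apply/matrixP => i j; rewrite !mxE !perm1.
apply: le_trans (LS_oracle hm m0 n0 nkm hD hLS hH) _.
by rewrite lerD2l.
Qed.

End RateConstants.

(** * Independence *)

Section Independence.
Context {R : realType} {dS : measure_display} {S : measurableType dS}.
Variable P : probability S R.
Implicit Types (G : set (set S)) (H : set S).

(** For fixed [H2] both sides are finite measures in [H1], and they agree on a pi-system that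
    contains the whole space. *)
Lemma indep_g_sigma_l G H2 : G `<=` measurable -> setI_closed G -> G setT ->
  measurable H2 -> (forall H1, G H1 -> P (H1 `&` H2) = (P H1 * P H2)%E) ->
  forall H1, <<s G >> H1 -> P (H1 `&` H2) = (P H1 * P H2)%E.
Proof.
move=> Gm GI GT mH2 h H1 GH1.
have p0 : 0 <= fine (P H2) by rewrite fine_ge0.
pose m2 := mscale (NngNum p0) P.
have m2E A : m2 A = (P A * P H2)%E.
  by rewrite /m2 /mscale/= fineK ?fin_num_measure// muleC.
rewrite -m2E -[LHS]/(mrestr P mH2 H1).
have cov : \bigcup_(k : nat) [set: S] = setT by rewrite bigcup_const.
apply: (@g_sigma_algebra_measure_unique _ _ _ G Gm (fun=> setT) (fun=> GT) cov
  (mrestr P mH2) m2) => //.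
- by move=> A GA; rewrite -[RHS]/(m2 A) m2E -h.
- move=> _; rewrite -[X in (X < _)%E]/(P (setT `&` H2)) setTI.
  by rewrite ltey_eq fin_num_measure.
Qed.

Definition indep_sigma G1 G2 := forall H1 H2, <<s G1 >> H1 -> <<s G2 >> H2 ->
  P (H1 `&` H2) = (P H1 * P H2)%E.

Lemma indep_g_sigma G1 G2 : G1 `<=` measurable -> G2 `<=` measurable ->
  setI_closed G1 -> setI_closed G2 -> G1 setT -> G2 setT ->
  (forall H1 H2, G1 H1 -> G2 H2 -> P (H1 `&` H2) = (P H1 * P H2)%E) ->
  indep_sigma G1 G2.
Proof.
move=> mG1 mG2 I1 I2 T1 T2 h H1 H2 sH1 sH2.
have smG1 : <<s G1 >> `<=` measurable.
  by apply: smallest_sub => //; exact: sigma_algebra_measurable.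
rewrite setIC muleC; apply: (indep_g_sigma_l mG2) => //; first exact: smG1.
move=> H G2H; rewrite setIC muleC; apply: (indep_g_sigma_l mG1) => //.
  exact: mG2.
by move=> H' G1H'; exact: h.
Qed.

Lemma measurable_id_g_sigma G : G `<=` measurable ->
  measurable_fun setT (id : S -> g_sigma_algebraType G).
Proof.
move=> Gm _ A mA; rewrite setTI preimage_id.
suff : <<s G >> `<=` measurable by apply.
by apply: smallest_sub => //; exact: sigma_algebra_measurable.
Qed.

(** Independence makes the law of the pair a product, so Tonelli integrates out [V2] with [V1]
    frozen. This takes the place of conditional expectation below, where [V1] is the identity of [S]
    onto a coarser sigma-algebra, so that [f] may involve many variables at once. *)
Lemma indep_fubini d1 d2 (T1 : measurableType d1) (T2 : measurableType d2)
    (V1 : S -> T1) (V2 : S -> T2) (f : T1 * T2 -> \bar R) :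
  measurable_fun setT V1 -> measurable_fun setT V2 ->
  (forall A1 A2, measurable A1 -> measurable A2 ->
    P (V1 @^-1` A1 `&` V2 @^-1` A2) = (P (V1 @^-1` A1) * P (V2 @^-1` A2))%E) ->
  measurable_fun setT f -> (forall z, 0 <= f z)%E ->
  (\int[P]_w f (V1 w, V2 w) = \int[P]_w \int[P]_w' f (V1 w, V2 w'))%E.
Proof.
move=> mV1 mV2 ind mf f0.
pose i1 : {mfun S >-> T1} := HB.pack V1 (isMeasurableFun.Build _ _ _ _ _ mV1).
pose i2 : {mfun S >-> T2} := HB.pack V2 (isMeasurableFun.Build _ _ _ _ _ mV2).
have mi12 : measurable_fun setT (fun w => (i1 w, i2 w)) by exact: measurable_fun_pair.
pose i12 : {mfun S >-> (T1 * T2)%type} :=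
  HB.pack (fun w => (i1 w, i2 w)) (isMeasurableFun.Build _ _ _ _ _ mi12).
transitivity (\int[distribution P i12]_z f z)%E.
  by rewrite ge0_integral_distribution.
transitivity (\int[distribution P i1 \x distribution P i2]_z f z)%E.
  apply/esym; apply: eq_measure_integral => A mA _.
  by apply: product_measure_unique => // A1 A2 mA1 mA2; rewrite -ind.
rewrite fubini_tonelli1// ge0_integral_distribution//; last 2 first.
- exact: measurable_fun_fubini_tonelli_F.
- by move=> w; apply: integral_ge0.
apply: eq_integral => w _; rewrite /comp /fubini_F/=.
by rewrite ge0_integral_distribution//; exact: measurableT_comp.
Qed.

Lemma measurable_indep_fubini d1 d2 (T1 : measurableType d1)
    (T2 : measurableType d2) (V1 : S -> T1) (V2 : S -> T2) (f : T1 * T2 -> \bar R) :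
  measurable_fun setT V1 -> measurable_fun setT V2 ->
  measurable_fun setT f -> (forall z, 0 <= f z)%E ->
  measurable_fun setT (fun w => \int[P]_w' f (V1 w, V2 w'))%E.
Proof.
move=> mV1 mV2 mf f0.
pose i2 : {mfun S >-> T2} := HB.pack V2 (isMeasurableFun.Build _ _ _ _ _ mV2).
rewrite (_ : (fun w => _) = (fubini_F (distribution P i2) f) \o V1).
  by apply: measurableT_comp => //; exact: measurable_fun_fubini_tonelli_F.
apply/funext => w; rewrite /comp /fubini_F ge0_integral_distribution//.
exact: measurableT_comp.
Qed.

End Independence.

(** * Borel-Cantelli and dyadic truncation *)

Section AlmostSure.
Context {R : realType} {dS : measure_display} {S : measurableType dS}.
Variable P : probability S R.

Lemma measurable_ge1 (f : S -> R) : measurable_fun setT f ->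
  measurable [set w | 1 <= f w].
Proof.
move=> mf; rewrite (_ : [set w | _] = f @^-1` `[1, +oo[).
  by rewrite -[X in measurable X]setTI; exact: mf.
by apply/seteqP; split => w /=; rewrite in_itv/= andbT.
Qed.

Lemma markov_ge1 (f : S -> R) : measurable_fun setT f -> (forall w, 0 <= f w) ->
  (P [set w | (1 <= f w)%R] <= \int[P]_w (f w)%:E)%E.
Proof.
move=> mf f0.
have mA := measurable_ge1 mf.
rewrite -[X in P X]setIT -integral_indic//; apply: ge0_le_integral => //.
- exact/measurable_EFinP.
- exact/measurable_EFinP.
move=> w _; rewrite lee_fin indicE.
have [/set_mem//|_] := boolP (w \in _); exact: f0.
Qed.

Lemma ae_eventually_lt1 (f : nat -> S -> R) (C : R) :
  (forall n, measurable_fun setT (f n)) -> (forall n w, 0 <= f n w) ->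
  (forall n, \sum_(0 <= k < n) \int[P]_w (f k w)%:E <= C%:E)%E ->
  {ae P, forall w, exists N : nat, forall n, (N <= n)%N -> f n w < 1}.
Proof.
move=> mf f0 fC.
pose F n := [set w | 1 <= f n w].
have mF n : measurable (F n) by exact: measurable_ge1.
exists (lim_sup_set F); split.
- apply: bigcapT_measurable => n.
  by apply: bigcup_measurable => k _; exact: mF.
- apply: lim_sup_set_cvg0 => //; apply: (@le_lt_trans _ _ C%:E); last exact: ltry.
  apply: lime_le; first by apply: is_cvg_nneseries => n _ _; exact: measure_ge0.
  apply: nearW => n; apply: le_trans (fC n).
  by apply: lee_sum => k _; exact: markov_ge1.
- move=> w /= hw n _; apply: contrapT => hn; apply: hw; exists n => k nk.
  by rewrite ltNge; apply/negP => h; apply: hn; exists k.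
Qed.

End AlmostSure.

Section DyadicTruncation.
Context {R : realType}.

(* The truncation profile of the three-series argument: it dominates both the
   tail indicator and the truncated second moment at level b ^ K. *)
Definition psi (b : R) (K : nat) (t : \bar R) : \bar R :=
  if (t <= (b ^+ K)%:E)%E then (t * t * ((b ^+ K)^-1)%:E)%E else (b ^+ K)%:E.

Lemma psi_ge0 (b : R) K t : 0 <= b -> (0 <= t)%E -> (0 <= psi b K t)%E.
Proof.
move=> b0 t0; rewrite /psi; case: ifP => _; last by rewrite lee_fin exprn_ge0.
by rewrite !mule_ge0// lee_fin invr_ge0 exprn_ge0.
Qed.

Lemma measurable_psi d (T : measurableType d) (b : R) K (g : T -> \bar R) :
  measurable_fun setT g -> measurable_fun setT (fun x => psi b K (g x)).
Proof.
move=> mg; rewrite /psi; apply: measurable_fun_ifT => //.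
- exact: measurable_fun_lee.
- by apply: emeasurable_funM => //; exact: emeasurable_funM.
Qed.

(** While [b ^ K < t] the terms are [b ^ K] and grow geometrically; afterwards they are
    [t^2 / b ^ K] and decay at least by halves. The summand [2 * t ^+ 2 / b ^+ n] reserves room for
    the remaining tail, which makes the induction close. *)
Let sum_psi_inv (b t : R) n : 2 <= b -> 0 <= t ->
  exists2 s : R, (\sum_(0 <= K < n) psi b K t%:E = s%:E)%E &
  if t <= b ^+ n then s + 2 * t ^+ 2 / b ^+ n <= 4 * t else s <= b ^+ n.
Proof.
move=> b2 t0; elim: n => [|n [s sE IH]].
  exists 0; first by rewrite big_nil.
  by rewrite expr0; case: ifP => [t1|_]; [nra|].
have bn : 0 < b ^+ n by rewrite exprn_gt0//; lra.
have bn1 : 2 * b ^+ n <= b ^+ n.+1 by rewrite exprS ler_wpM2r// ltW.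
have bn1' : 0 < b ^+ n.+1 by rewrite exprn_gt0//; lra.
exists (s + if t <= b ^+ n then t ^+ 2 / b ^+ n else b ^+ n).
  by rewrite big_nat_recr//= sE /psi lee_fin; case: ifP => _; rewrite -?EFinM -EFinD.
case: (leP t (b ^+ n)) IH => [tn IH|tn IH].
  rewrite (le_trans tn); last by apply: le_trans bn1; lra.
  apply: le_trans IH; rewrite -addrA lerD2l.
  have : t ^+ 2 / b ^+ n.+1 <= t ^+ 2 / (2 * b ^+ n).
    by rewrite ler_wpM2l ?sqr_ge0// lef_pV2 ?posrE ?mulr_gt0.
  have -> : t ^+ 2 / (2 * b ^+ n) = 2^-1 * (t ^+ 2 / b ^+ n) by field; rewrite gt_eqF.
  rewrite -[2 * t ^+ 2 / _]mulrA; lra.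
case: ifP => tn1; last by lra.
have : t ^+ 2 / b ^+ n.+1 <= t.
  by rewrite ler_pdivrMr// expr2 ler_wpM2l.
by rewrite -[2 * t ^+ 2 / _]mulrA; lra.
Qed.

(** This is why a first moment suffices: summed over all dyadic levels, tails and truncated second
    moments together cost at most four times the variable itself. *)
Lemma sum_psi_le (b : R) (t : \bar R) n : 2 <= b -> (0 <= t)%E ->
  (\sum_(0 <= K < n) psi b K t <= 4%:E * t)%E.
Proof.
move=> b2; case: t => [t|_|//]; last by rewrite gt0_muley ?lte_fin// leey.
rewrite lee_fin => t0.
have [s -> h] := sum_psi_inv n b2 t0; rewrite -EFinM lee_fin.
have bn : 0 < b ^+ n by rewrite exprn_gt0//; lra.
case: (leP t (b ^+ n)) h => [_|]; last by lra.
have : 0 <= 2 * t ^+ 2 / b ^+ n by rewrite divr_ge0 ?mulr_ge0 ?sqr_ge0// ltW.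
lra.
Qed.

End DyadicTruncation.

Section CovarianceBound.
Context {R : realType}.

(* The flags record which of i = k, i = l, j = k, j = l hold for the covariance
   of the terms indexed by (i, j) and (k, l). *)
Definition covbound (m b1 b2 : R) (p q r s : bool) : R :=
  m ^+ 2 + (p%:R + q%:R + r%:R + s%:R) * b1 + (p%:R * s%:R + q%:R * r%:R) * b2.

Lemma covbound_b2 (m b1 b2 : R) p q r s : 0 <= b1 -> 0 <= b2 ->
  (p && s) || (q && r) -> b2 <= covbound m b1 b2 p q r s.
Proof.
move=> h1 h2; rewrite /covbound; move: (m ^+ 2) (sqr_ge0 m) => M M0.
by case: p; case: q; case: r; case: s => //= _; lra.
Qed.

Lemma covbound_b1 (m b1 b2 : R) p q r s : 0 <= b1 -> 0 <= b2 ->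
  [|| p, q, r | s] -> b1 <= covbound m b1 b2 p q r s.
Proof.
move=> h1 h2; rewrite /covbound; move: (m ^+ 2) (sqr_ge0 m) => M M0.
by case: p; case: q; case: r; case: s => //= _; lra.
Qed.

End CovarianceBound.

(** * The sampling scheme *)

Section Sampling.
Context {R : realType} {d : measure_display} {T : measurableType d}
  {mu : probability T R} {dS : measure_display} {S : measurableType dS}
  {P : probability S R} {X : nat -> S -> T} {U : nat -> nat -> S -> R}.
Hypothesis hs : sampling_scheme mu P X U.

Let ltp (e : nat * nat) := (e.1 < e.2)%N.

Definition cylinder (F : seq nat) (E : seq (nat * nat)) (A : nat -> set T)
    (B : nat * nat -> set R) : set S :=
  \bigcap_(i in [set` F]) (X i @^-1` A i) `&`
  \bigcap_(e in [set` E]) (U e.1 e.2 @^-1` B e).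

(** A pi-system for the variables indexed by [F] and [E]; [g_sigma_algebraType] of it makes [S] the
    space of what these variables reveal. *)
Definition cylinders (F : seq nat) (E : seq (nat * nat)) : set (set S) :=
  [set H | exists A B, [/\ forall i, measurable (A i), forall e, measurable (B e)
    & H = cylinder F E A B]].

Lemma measurable_X i : measurable_fun setT (X i).
Proof. by case: hs => + _; exact. Qed.

Lemma measurable_U e : ltp e -> measurable_fun setT (U e.1 e.2).
Proof. by case: hs => _ [+ _]; exact. Qed.

Lemma cylinders_measurable F E : all ltp E -> cylinders F E `<=` measurable.
Proof.
move=> /allP hE _ [A [B [mA mB ->]]]; apply: measurableI.
  apply: fin_bigcap_measurable => // i _.
  by rewrite -[X in measurable X]setTI; exact: measurable_X.
apply: fin_bigcap_measurable => // e /hE he.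
by rewrite -[X in measurable X]setTI; exact: (measurable_U he).
Qed.

Lemma cylinders_setI_closed F E : setI_closed (cylinders F E).
Proof.
move=> _ _ [A [B [mA mB ->]]] [A' [B' [mA' mB' ->]]].
exists (fun i => A i `&` A' i), (fun e => B e `&` B' e); split.
- by move=> i; exact: measurableI.
- by move=> i; exact: measurableI.
apply/seteqP; split => w /=.
  move=> [[h1 h2] [h3 h4]]; split => i hi; split;
  [exact: h1|exact: h3|exact: h2|exact: h4].
move=> [h1 h2]; split; split => i hi;
[by case: (h1 i hi)|by case: (h2 i hi)|by case: (h1 i hi)|by case: (h2 i hi)].
Qed.

Lemma cylindersT F E : cylinders F E setT.
Proof. by exists (fun=> setT), (fun=> setT); split => //; apply/seteqP; split. Qed.

Lemma cylinder_prob F E A B : uniq F -> uniq E -> all ltp E ->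
  (forall i, measurable (A i)) -> (forall e, measurable (B e)) ->
  P (cylinder F E A B) = ((\prod_(i <- F) fine (P (X i @^-1` A i))) *
     (\prod_(e <- E) fine (P (U e.1 e.2 @^-1` B e))))%:E.
Proof.
move=> uF uE hE mA mB; have [_ [_ [_ [_ /(_ F E A B uF uE hE mA mB) <-]]]] := hs.
rewrite fineK// fin_num_measure//.
by apply: (cylinders_measurable hE); exists A, B.
Qed.

(** For disjoint index lists two cylinders meet in one cylinder over the concatenated lists, to
    which the product formula of [sampling_scheme] applies. *)
Lemma cylinders_indep F1 F2 E1 E2 : uniq (F1 ++ F2) -> uniq (E1 ++ E2) ->
  all ltp (E1 ++ E2) -> indep_sigma P (cylinders F1 E1) (cylinders F2 E2).
Proof.
move=> uF uE aE; have := aE; rewrite all_cat => /andP[aE1 aE2].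
have := uF; have := uE; rewrite !cat_uniq.
move=> /and3P[uE1 /hasPn dE uE2] /and3P[uF1 /hasPn dF uF2].
apply: indep_g_sigma; [exact: cylinders_measurable|exact: cylinders_measurable|
  exact: cylinders_setI_closed|exact: cylinders_setI_closed|exact: cylindersT|
  exact: cylindersT|].
move=> _ _ [A1 [B1 [mA1 mB1 ->]]] [A2 [B2 [mA2 mB2 ->]]].
pose A i := if i \in F1 then A1 i else A2 i.
pose B e := if e \in E1 then B1 e else B2 e.
have mA i : measurable (A i) by rewrite /A; case: ifP.
have mB e : measurable (B e) by rewrite /B; case: ifP.
have -> : cylinder F1 E1 A1 B1 `&` cylinder F2 E2 A2 B2 =
          cylinder (F1 ++ F2) (E1 ++ E2) A B.
  apply/seteqP; split => w /=.
    move=> [[h1 h2] [h3 h4]]; split => i /=; rewrite mem_cat.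
      by rewrite /A; case: ifP => [hi _|_ /= hi]; [exact: h1|exact: h3].
    by rewrite /B; case: ifP => [hi _|_ /= hi]; [exact: h2|exact: h4].
  move=> [h1 h2]; split; split => i /= hi.
  - by have := h1 i; rewrite /= mem_cat hi /A hi; apply.
  - by have := h2 i; rewrite /= mem_cat hi /B hi; apply.
  - by have := h1 i; rewrite /= mem_cat hi orbT /A (negbTE (dF _ hi)); apply.
  - by have := h2 i; rewrite /= mem_cat hi orbT /B (negbTE (dE _ hi)); apply.
rewrite !cylinder_prob// -EFinM; congr EFin; rewrite !big_cat/= mulrACA.
congr (_ * _ * (_ * _)); apply: eq_big_seq => i hi.
- by rewrite /A hi.
- by rewrite /B hi.
- by rewrite /A (negbTE (dF _ hi)).
- by rewrite /B (negbTE (dE _ hi)).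
Qed.

Lemma measurable_X_cylinders F E i : i \in F ->
  measurable_fun setT (X i : g_sigma_algebraType (cylinders F E) -> T).
Proof.
move=> hi _ A mA; rewrite setTI; apply: sub_sigma_algebra.
exists (fun j => if j == i then A else setT), (fun=> setT); split => //.
  by move=> j; case: ifP.
apply/seteqP; split => w /=.
  by move=> h; split => // j /= _; case: eqP => // ->.
by case=> /(_ i hi)/=; rewrite eqxx.
Qed.

Lemma measurable_U_cylinders F E e : e \in E ->
  measurable_fun setT (U e.1 e.2 : g_sigma_algebraType (cylinders F E) -> R).
Proof.
move=> he _ A mA; rewrite setTI; apply: sub_sigma_algebra.
exists (fun=> setT), (fun j => if j == e then A else setT); split => //.
  by move=> j; case: ifP.
apply/seteqP; split => w /=.
  by move=> h; split => // j /= _; case: eqP => // ->.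
by case=> _ /(_ e he)/=; rewrite eqxx.
Qed.

Lemma integral_X i (h : T -> \bar R) : measurable_fun setT h ->
  (forall x, 0 <= h x)%E -> (\int[P]_w h (X i w) = \int[mu]_x h x)%E.
Proof.
move=> mh h0.
pose Xi : {mfun S >-> T} := HB.pack (X i) (isMeasurableFun.Build _ _ _ _ _ (measurable_X i)).
transitivity (\int[distribution P Xi]_x h x)%E.
  by rewrite ge0_integral_distribution.
apply: eq_measure_integral => A mA _.
by have [_ [_ [lawX _]]] := hs; exact: lawX.
Qed.

Lemma indep_cylinders_X F E l : all ltp E -> uniq E -> uniq F -> l \notin F ->
  forall (A1 : set (g_sigma_algebraType (cylinders F E))) (A2 : set T),
  measurable A1 -> measurable A2 ->
  P (A1 `&` X l @^-1` A2) = (P A1 * P (X l @^-1` A2))%E.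
Proof.
move=> aE uE uF lF A1 A2 mA1 mA2.
apply: (@cylinders_indep F [:: l] E [::]); rewrite ?cats0//.
  by rewrite cats1 rcons_uniq lF.
rewrite -[X in <<s _ >> X]setTI.
by have := @measurable_X_cylinders [:: l] [::] l; rewrite mem_seq1 eqxx; apply.
Qed.

Lemma indep_cylinders_U F E e : all ltp (e :: E) -> uniq (e :: E) -> uniq F ->
  forall (A1 : set (g_sigma_algebraType (cylinders F E))) (A2 : set R),
  measurable A1 -> measurable A2 ->
  P (A1 `&` U e.1 e.2 @^-1` A2) = (P A1 * P (U e.1 e.2 @^-1` A2))%E.
Proof.
move=> aE uE uF A1 A2 mA1 mA2.
apply: (@cylinders_indep F [::] E [:: e]); rewrite ?cats0 ?cats1//.
- by rewrite rcons_uniq.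
- by rewrite all_rcons.
rewrite -[X in <<s _ >> X]setTI.
by have := @measurable_U_cylinders [::] [:: e] e; rewrite mem_seq1 eqxx; apply.
Qed.

(** Integrates out a fresh latent point while all points in [F] stay frozen; repeated use peels off
    the moments below one index at a time. *)
Lemma integral_cond_X F l (h : g_sigma_algebraType (cylinders F [::]) * T -> \bar R) :
  uniq F -> l \notin F -> measurable_fun setT h -> (forall z, 0 <= h z)%E ->
  (\int[P]_w h (w, X l w) = \int[P]_w \int[mu]_y h (w, y))%E.
Proof.
move=> uF lF mh h0.
rewrite (@indep_fubini _ _ _ P _ _ (g_sigma_algebraType (cylinders F [::])) T id (X l) h)//.
- apply: eq_integral => w _; rewrite (integral_X l (h := fun y => h (w, y)))//.
  apply: (measurableT_comp mh).
  exact: (@pair1_measurable _ _ (g_sigma_algebraType (cylinders F [::])) T w).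
- exact: measurable_id_g_sigma (cylinders_measurable _).
- exact: measurable_X.
- by move=> A1 A2 mA1 mA2; rewrite (@indep_cylinders_X F [::] l).
Qed.

(** * Moments of a kernel at distinct latent points *)

Section Moments.
Variable f : T * T -> \bar R.
Hypotheses (mf : measurable_fun setT f) (f0 : forall z, (0 <= f z)%E).
Let g x := (\int[mu]_y f (x, y))%E.

Let mg : measurable_fun setT g.
Proof. exact: measurable_fun_fubini_tonelli_F. Qed.

Let g0 x : (0 <= g x)%E.
Proof. exact: integral_ge0. Qed.

Let mfX i j F E : i \in F -> j \in F -> measurable_fun setT
  (fun z : g_sigma_algebraType (cylinders F E) * T => f (X i z.1, X j z.1)).
Proof.
move=> iF jF; apply: measurableT_comp => //.
by apply: measurable_fun_pair; apply: measurableT_comp => //;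
  exact: measurable_X_cylinders.
Qed.

Let mfXS i j : measurable_fun setT (fun w => f (X i w, X j w)).
Proof.
by apply: measurableT_comp => //; apply: measurable_fun_pair; exact: measurable_X.
Qed.

Let mfX1 i F E : i \in F -> measurable_fun setT
  (fun z : g_sigma_algebraType (cylinders F E) * T => f (X i z.1, z.2)).
Proof.
move=> iF; apply: measurableT_comp => //; apply: measurable_fun_pair => //.
by apply: measurableT_comp => //; exact: measurable_X_cylinders.
Qed.

Lemma integral_X2 i j : i != j ->
  (\int[P]_w f (X i w, X j w) = \int[mu \x mu]_z f z)%E.
Proof.
move=> ij.
rewrite (@integral_cond_X [:: i] j (fun z => f (X i z.1, z.2)))//=.
- by rewrite (integral_X i (h := g))// fubini_tonelli1.
- by rewrite mem_seq1 eq_sym.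
- by apply: mfX1; rewrite mem_seq1.
Qed.

Lemma integral_X3 i j l : uniq [:: i; j; l] ->
  (\int[P]_w (f (X i w, X j w) * f (X i w, X l w)) = \int[mu]_x (g x * g x))%E.
Proof.
move=> /=; rewrite !inE !negb_or => /and3P[/andP[ij il] jl _].
rewrite (@integral_cond_X [:: i; j] l
  (fun z => f (X i z.1, X j z.1) * f (X i z.1, z.2))%E)//=; last 4 first.
- by rewrite inE ij.
- by rewrite !inE negb_or eq_sym il eq_sym jl.
- apply: emeasurable_funM; last by apply: mfX1; rewrite inE eqxx.
  by apply: mfX; rewrite !inE eqxx ?orbT.
- by move=> z; exact: mule_ge0.
transitivity (\int[P]_w (f (X i w, X j w) * g (X i w)))%E.
  apply: eq_integral => w _; rewrite /= ge0_integralZl//.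
  exact: measurableT_comp mf (pair1_measurable _).
have mfg : measurable_fun setT (fun z : T * T => f z * g z.1)%E.
  by apply: emeasurable_funM => //; exact: measurableT_comp.
rewrite (@integral_cond_X [:: i] j (fun z => f (X i z.1, z.2) * g (X i z.1))%E)//=.
- rewrite (integral_X i (h := fun x => \int[mu]_y (f (x, y) * g x))%E).
  + apply: eq_integral => x _; rewrite ge0_integralZr//.
    exact: measurableT_comp mf (pair1_measurable _).
  + apply: (measurable_fun_fubini_tonelli_F (fun z => f z * g z.1)%E) => //.
    by move=> z; exact: mule_ge0.
  + by move=> x; apply: integral_ge0 => y _; exact: mule_ge0.
- by rewrite mem_seq1 eq_sym.
- apply: emeasurable_funM; first by apply: mfX1; rewrite mem_seq1.
  apply: measurableT_comp => //; apply: measurableT_comp => //.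
  by apply: measurable_X_cylinders; rewrite mem_seq1.
- by move=> z; exact: mule_ge0.
Qed.

Lemma integral_X4 i j k l : uniq [:: i; j; k; l] ->
  (\int[P]_w (f (X i w, X j w) * f (X k w, X l w)) =
   (\int[mu \x mu]_z f z) * (\int[mu \x mu]_z f z))%E.
Proof.
move=> u4; have u2 : i != j by move: u4; rewrite /= !inE !negb_or => /and3P[/and3P[]].
have u3 : uniq [:: i; j] /\ k \notin [:: i; j].
  split; first by rewrite /= inE u2.
  move: u4; rewrite /= !inE !negb_or => /and3P[/and3P[_ ik _] /andP[jk _] _].
  by rewrite eq_sym ik eq_sym jk.
have l3 : uniq [:: i; j; k] /\ l \notin [:: i; j; k].
  by move: u4; rewrite -[[:: i; j; k; l]]/(rcons [:: i; j; k] l) rcons_uniq => /andP[].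
rewrite (@integral_cond_X [:: i; j; k] l
  (fun z => f (X i z.1, X j z.1) * f (X k z.1, z.2))%E); last 4 first.
- by case: l3.
- by case: l3.
- apply: emeasurable_funM; last by apply: mfX1; rewrite !inE eqxx !orbT.
  by apply: mfX; rewrite !inE eqxx ?orbT.
- by move=> z; exact: mule_ge0.
transitivity (\int[P]_w (f (X i w, X j w) * g (X k w)))%E.
  apply: eq_integral => w _; rewrite /= ge0_integralZl//.
  exact: measurableT_comp mf (pair1_measurable _).
rewrite (@integral_cond_X [:: i; j] k (fun z => f (X i z.1, X j z.1) * g z.2)%E).
- transitivity (\int[P]_w (f (X i w, X j w) * \int[mu]_x g x))%E.
    by apply: eq_integral => w _; rewrite /= ge0_integralZl.
  rewrite ge0_integralZr//=; last by apply: integral_ge0.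
  by rewrite integral_X2//; congr (_ * _)%E; rewrite fubini_tonelli1.
- by case: u3.
- by case: u3.
- apply: emeasurable_funM; last exact: measurableT_comp.
  by apply: mfX; rewrite !inE eqxx ?orbT.
- by move=> z; exact: mule_ge0.
Qed.

End Moments.

(** The compensated exponential [exp (a (A - q) - 2 a^2 q)] of a centred edge, where [A] indicates
    [u < q]. The compensator is linear in [q], as the variance is for small [q]; this is what brings
    the factor [rho] into the final bound. *)
Definition expdev (a q u : R) : R :=
  if u < q then expR (a * (1 - q) - 2 * a ^+ 2 * q)
  else expR (a * (0 - q) - 2 * a ^+ 2 * q).

Lemma expdev_ge0 a q u : 0 <= expdev a q u.
Proof. by rewrite /expdev; case: ifP => _; exact: expR_ge0. Qed.

(** From [exp a <= 1 / (1 - a)] and [(1 + a + 2 a^2) (1 - a) = 1 + a^2 (1 - 2 a)]. *)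
Lemma expR_le_quadratic (a : R) : a <= 2^-1 -> expR a <= 1 + a + 2 * a ^+ 2.
Proof.
move=> a2.
have h1 : 1 - a <= expR (- a) by have := expR_ge1Dx (- a).
have h2 : 0 < 1 - a by lra.
apply: (@le_trans _ _ (1 - a)^-1).
  by rewrite -[expR a]invrK -expRN lef_pV2 ?posrE ?expR_gt0.
rewrite -[leLHS]mul1r ler_pdivrMr//.
have : 0 <= a ^+ 2 * (1 - 2 * a) by rewrite mulr_ge0 ?sqr_ge0//; lra.
by move=> h3; rewrite -subr_ge0; apply: le_trans h3 _; rewrite le_eqVlt; apply/orP; left; apply/eqP; ring.
Qed.

Lemma bernoulli_mgf (a q : R) : a <= 2^-1 -> 0 <= q <= 1 ->
  expR (a * (1 - q) - 2 * a ^+ 2 * q) * q +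
  expR (a * (0 - q) - 2 * a ^+ 2 * q) * (1 - q) <= 1.
Proof.
move=> a2 /andP[q0 q1].
have -> : a * (1 - q) - 2 * a ^+ 2 * q = a + (- (q * (a + 2 * a ^+ 2))) by ring.
have -> : a * (0 - q) - 2 * a ^+ 2 * q = - (q * (a + 2 * a ^+ 2)) by ring.
rewrite expRD expRN; set b := q * _.
have -> : expR a / expR b * q + (expR b)^-1 * (1 - q) =
  (1 + q * (expR a - 1)) / expR b by ring.
rewrite ler_pdivrMr ?expR_gt0// mul1r.
apply: le_trans (expR_ge1Dx b); rewrite lerD2l ler_wpM2l//.
by have := expR_le_quadratic a2; lra.
Qed.

Lemma U_lt_prob e (q : R) : ltp e -> 0 <= q <= 1 ->
  P (U e.1 e.2 @^-1` `]-oo, q[) = q%:E.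
Proof.
move=> he /andP[q0 q1].
have [_ [_ [_ [lawU _]]]] := hs.
rewrite lawU//.
have -> : (`]-oo, q[ `&` `[0, 1])%classic = `[0, q[%classic :> set R.
  apply/seteqP; split => x /=; rewrite !in_itv/=.
    by move=> [-> /andP[-> _]].
  by move=> /andP[x0 xq]; rewrite x0 xq; split => //=; rewrite (le_trans (ltW xq)).
rewrite lebesgue_measure_itv/= lte_fin; case: ltgtP q0 => // [q0 _|<- _].
  by rewrite -EFinB subr0.
by [].
Qed.

Lemma integral_expdev e a (q : R) : ltp e -> a <= 2^-1 -> 0 <= q <= 1 ->
  (\int[P]_w (expdev a q (U e.1 e.2 w))%:E <= 1)%E.
Proof.
move=> he a2 hq.
set A := U e.1 e.2 @^-1` `]-oo, q[.
have mA : measurable A.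
  by rewrite /A -[X in measurable X]setTI; exact: (measurable_U he).
set al := expR (a * (1 - q) - 2 * a ^+ 2 * q).
set be := expR (a * (0 - q) - 2 * a ^+ 2 * q).
have -> : (\int[P]_w (expdev a q (U e.1 e.2 w))%:E =
   \int[P]_w (al%:E * (\1_A w)%:E + be%:E * (\1_(~` A) w)%:E))%E.
  apply: eq_integral => w _; rewrite -!EFinM -EFinD; congr EFin.
  rewrite !indicE /expdev in_setC.
  have -> : (w \in A) = (U e.1 e.2 w < q).
    by apply/idP/idP => [/set_mem|h]; [|apply/mem_set]; rewrite /A/= in_itv.
  rewrite -/al -/be.
  by case: (U e.1 e.2 w < q); rewrite /= ?mulr0 ?mulr1 ?addr0 ?add0r.
rewrite ge0_integralD//=; last 4 first.
- by move=> w _; rewrite -EFinM lee_fin mulr_ge0// expR_ge0.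
- by apply: measurable_funeM; exact/measurable_EFinP.
- by move=> w _; rewrite -EFinM lee_fin mulr_ge0// expR_ge0.
- by apply: measurable_funeM; apply/measurable_EFinP; apply: measurable_indic; exact: measurableC.
have E1 (c : R) B : 0 <= c -> measurable B ->
    (\int[P]_w (c%:E * (\1_B w)%:E) = c%:E * P B)%E.
  move=> c0 mB; rewrite ge0_integralZl_EFin//.
  - by rewrite integral_indic// setIT.
  - exact/measurable_EFinP.
rewrite !E1 ?expR_ge0//; last exact: measurableC.
rewrite probability_setC// U_lt_prob//.
by rewrite -EFinB -!EFinM -EFinD lee_fin; exact: bernoulli_mgf.
Qed.

(** * Exponential moments of the signed edge deviations *)

Section ExpMoment.
Variables (W : T -> T -> R) (rho : R).
Hypotheses (gW : is_graphon W) (rho0 : 0 <= rho).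

Let q (e : nat * nat) (w : S) := Num.min 1 (rho * W (X e.1 w) (X e.2 w)).

Let q01 e w : 0 <= q e w <= 1.
Proof.
case: gW => _ [W0 _].
by rewrite le_min ler01 mulr_ge0//= ge_min lexx.
Qed.

Let mq F E e : e.1 \in F -> e.2 \in F ->
  measurable_fun setT (q e : g_sigma_algebraType (cylinders F E) -> R).
Proof.
move=> h1 h2; apply: measurable_minr => //; apply: measurable_funM => //.
case: gW => mW _.
have mp : measurable_fun setT
    (fun w : g_sigma_algebraType (cylinders F E) => (X e.1 w, X e.2 w)).
  by apply: measurable_fun_pair; exact: measurable_X_cylinders.
exact: (measurableT_comp mW mp).
Qed.

Let mexpdev d' (T' : measurableType d') (a : R) (f g : T' -> R) :
  measurable_fun setT f -> measurable_fun setT g ->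
  measurable_fun setT (fun z => expdev a (f z) (g z)).
Proof.
move=> mf mg; rewrite /expdev; apply: measurable_fun_ifT.
- exact: measurable_fun_ltr.
- apply: measurableT_comp => //; apply: measurable_funB.
    by apply: measurable_funM => //; exact: measurable_funB.
  exact: measurable_funM.
- apply: measurableT_comp => //; apply: measurable_funB.
    by apply: measurable_funM => //; exact: measurable_funB.
  exact: measurable_funM.
Qed.

(** Induction on the edges: the uniform variable of the head edge is independent of all the latent
    points and of the other uniforms, so with these frozen its factor integrates to at most 1. *)
Lemma integral_prod_expdev (I : eqType) (e : I -> nat * nat) (a : I -> R) n (r : seq I) :
  uniq (map e r) -> all ltp (map e r) ->
  (forall i, (e i).1 < n /\ (e i).2 < n)%N -> (forall i, a i <= 2^-1) ->
  (\int[P]_w (\prod_(i <- r) expdev (a i) (q (e i) w) (U (e i).1 (e i).2 w))%:E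
    <= 1)%E.
Proof.
move=> + + en a2; elim: r => [|i r IH].
  move=> _ _; under eq_integral do rewrite big_nil.
  by rewrite integral_cst// mul1e; exact: probability_le1.
move=> uE aE; have /= /andP[ei ur] := uE; have /= /andP[li ar] := aE.
set F := iota 0 n; set E := map e r.
have mem_F j : ((e j).1 \in F) /\ ((e j).2 \in F).
  by rewrite /F !mem_iota !add0n; exact: en.
pose g (w : S) := \prod_(j <- r) expdev (a j) (q (e j) w) (U (e j).1 (e j).2 w).
have g0 w : 0 <= g w by apply: prodr_ge0 => j _; exact: expdev_ge0.
have mg : measurable_fun setT (g : g_sigma_algebraType (cylinders F E) -> R).
  apply: measurable_prod => j jr; apply: mexpdev.
    by apply: mq; case: (mem_F j).
  by apply: measurable_U_cylinders; exact: map_f.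
pose h (z : g_sigma_algebraType (cylinders F E) * R) :=
  (expdev (a i) (q (e i) z.1) z.2 * g z.1)%:E.
have mh : measurable_fun setT h.
  apply/measurable_EFinP; apply: measurable_funM; last exact: measurableT_comp.
  apply: mexpdev => //; have [e1 e2] := mem_F i.
  exact: (measurableT_comp (mq (E := E) e1 e2) measurable_fst).
have -> : (\int[P]_w (\prod_(j <- i :: r)
    expdev (a j) (q (e j) w) (U (e j).1 (e j).2 w))%:E =
  \int[P]_w h (w, U (e i).1 (e i).2 w))%E.
  by apply: eq_integral => w _; rewrite big_cons.
rewrite (@indep_fubini _ _ _ P _ _ (g_sigma_algebraType (cylinders F E)) R id
  (U (e i).1 (e i).2) h)//; last 4 first.
- by apply: measurable_id_g_sigma; exact: cylinders_measurable.
- exact: (measurable_U li).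
- by move=> A1 A2 mA1 mA2; apply: (@indep_cylinders_U F E (e i)) => //; exact: iota_uniq.
- by move=> z; rewrite lee_fin mulr_ge0// expdev_ge0.
apply: le_trans (IH ur ar).
apply: ge0_le_integral => //.
- by move=> w _; apply: integral_ge0 => w' _; rewrite lee_fin mulr_ge0// expdev_ge0.
- apply: (@measurable_indep_fubini _ _ _ P _ _ (g_sigma_algebraType (cylinders F E)) R
    id (U (e i).1 (e i).2) h) => //.
  + by apply: measurable_id_g_sigma; exact: cylinders_measurable.
  + exact: (measurable_U li).
  + by move=> z; rewrite lee_fin mulr_ge0// expdev_ge0.
- apply/measurable_EFinP; apply: (measurableT_comp mg).
  by apply: measurable_id_g_sigma; exact: cylinders_measurable.
move=> w _; rewrite /h/=; under eq_integral do rewrite EFinM.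
rewrite ge0_integralZr//; last 3 first.
- by apply/measurable_EFinP; apply: mexpdev => //; exact: (measurable_U li).
- by move=> w' _; rewrite lee_fin expdev_ge0.
- by rewrite lee_fin.
rewrite -[leRHS]mul1e; apply: lee_wpmul2r; first by rewrite lee_fin.
exact: integral_expdev.
Qed.

Let mqS e : measurable_fun setT (q e).
Proof.
apply: measurable_minr => //; apply: measurable_funM => //.
case: gW => mW _.
have mp : measurable_fun setT (fun w => (X e.1 w, X e.2 w)).
  by apply: measurable_fun_pair; exact: measurable_X.
exact: (measurableT_comp mW mp).
Qed.

Local Notation Qw n w := (Qmx W rho n (fun i => X i w)).
Local Notation Aw n w := (Gadj W rho n (fun i => X i w) (fun i j => U i j w)).

Let QE n w (i j : 'I_n) : Qw n w i j = if i == j then 0 else q (val i, val j) w.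
Proof. by rewrite mxE. Qed.

Let qC i j w : q (i, j) w = q (j, i) w.
Proof. by case: gW => _ [_ Wsym]; rewrite /q/= Wsym. Qed.

Let QC n w (i j : 'I_n) : Qw n w i j = Qw n w j i.
Proof. by rewrite !QE eq_sym qC. Qed.

Let AC n w (i j : 'I_n) : Aw n w i j = Aw n w j i.
Proof. by rewrite [LHS]mxE [RHS]mxE QC eq_sym minnC maxnC. Qed.

Let ltE n w (i j : 'I_n) : (i < j)%N ->
  Qw n w i j = q (val i, val j) w /\
  Aw n w i j = (U i j w < q (val i, val j) w)%R%:R.
Proof.
move=> ij; have nij : i != j by rewrite -val_eqE/= ltn_eqF.
rewrite QE [Aw n w i j]mxE QE (negbTE nij); split => //=.
by rewrite (minn_idPl (ltnW ij)) (maxn_idPr (ltnW ij)); case: ltP.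
Qed.

Let Q0 n w (i : 'I_n) : Qw n w i i = 0.
Proof. by rewrite QE eqxx. Qed.

Let A0 n w (i : 'I_n) : Aw n w i i = 0.
Proof. by rewrite mxE eqxx. Qed.

Let Q_ge0 n w (i j : 'I_n) : 0 <= Qw n w i j.
Proof. by rewrite QE; case: ifP => // _; case/andP: (q01 (val i, val j) w). Qed.

Let mQ n i j : measurable_fun setT (fun w => Qw n w i j).
Proof.
rewrite (_ : (fun w => _) = if i == j then cst 0 else q (val i, val j)).
  by case: ifP.
by apply/funext => w; rewrite QE; case: ifP.
Qed.

Let mA n i j : measurable_fun setT (fun w => Aw n w i j).
Proof.
wlog ij : i j / (i <= j)%N => [h|].
  have [/h//|/ltnW/h] := leqP i j.
  by rewrite (_ : (fun w => Aw n w j i) = fun w => Aw n w i j)//; apply/funext => w.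
have [<-|nij] := eqVneq i j.
  by rewrite (_ : (fun w => _) = cst 0)//; apply/funext => w; rewrite A0.
have lij : (i < j)%N by rewrite ltn_neqAle ij andbT.
rewrite (_ : (fun w => _) = fun w => if U i j w < q (val i, val j) w then 1 else 0).
  apply: measurable_fun_ifT => //; apply: measurable_fun_ltr => //.
  exact: (@measurable_U (val i, val j)).
by apply/funext => w; have [_ ->] := ltE w lij; case: ltP.
Qed.

Lemma sum_offdiag n (F : 'I_n -> 'I_n -> R) : (forall i, F i i = 0) ->
  \sum_i \sum_j F i j =
  \sum_(p : 'I_n * 'I_n | (p.1 < p.2)%N) (F p.1 p.2 + F p.2 p.1).
Proof.
move=> F0; rewrite pair_bigA/= (bigID (fun p : 'I_n * 'I_n => (p.1 < p.2)%N))/=.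
rewrite big_split/=; congr (_ + _).
rewrite (reindex_inj (h := fun p : 'I_n * 'I_n => (p.2, p.1)))/=; last first.
  by move=> [a b] [a' b'] /= [-> ->].
rewrite (bigID (fun p : 'I_n * 'I_n => p.1 == p.2))/= big1 ?add0r.
  apply: eq_bigl => -[a b] /=; rewrite -leqNgt ltn_neqAle andbC.
  by rewrite -val_eqE.
by move=> [a b] /= /andP[_ /eqP ->].
Qed.

Definition tilt n (s : 'I_n -> 'I_n -> R) (theta : R) (w : S) : R :=
  theta * (\sum_i \sum_j s i j * (Aw n w - Qw n w) i j)
  - 4 * theta ^+ 2 * (\sum_i \sum_j Qw n w i j).

Lemma measurable_tilt n (s : 'I_n -> 'I_n -> R) (theta : R) :
  measurable_fun setT (tilt s theta).
Proof.
apply: measurable_funB; apply: measurable_funM => //.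
  apply: measurable_sum => i; apply: measurable_sum => j.
  rewrite (_ : (fun w => _) = fun w => s i j * (Aw n w i j - Qw n w i j)).
    by apply: measurable_funM => //; exact: measurable_funB.
  by apply/funext => w; rewrite !mxE.
by apply: measurable_sum => i; apply: measurable_sum => j.
Qed.

(** One uniform drives both entries of an unordered pair, which gives the edge a weight [a p] of
    size at most [2 theta]. Hence the threshold 1/4 on [theta], to ensure [a p <= 1/2], and the
    factor 4 in [tilt]: [2 (a p)^2 <= 8 theta^2], shared between the two entries. *)
Lemma integral_exp_tilt n (s : 'I_n -> 'I_n -> R) (theta : R) :
  0 <= theta <= 4^-1 -> (forall i j, `|s i j| <= 1) ->
  (\int[P]_w (expR (tilt s theta w))%:E <= 1)%E.
Proof.
move=> /andP[t0 t1] s1.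
pose r := enum [pred p : 'I_n * 'I_n | (p.1 < p.2)%N].
pose e (p : 'I_n * 'I_n) := (val p.1, val p.2).
pose a (p : 'I_n * 'I_n) := theta * (s p.1 p.2 + s p.2 p.1).
have aR p : `|a p| <= 2 * theta.
  rewrite normrM ger0_norm// mulrC ler_wpM2r// (le_trans (ler_normD _ _))//.
  by have := s1 p.1 p.2; have := s1 p.2 p.1; lra.
have ltr p : p \in r -> (p.1 < p.2)%N by rewrite mem_enum inE.
have einj : injective e by move=> [i j] [i' j'] [/val_inj -> /val_inj ->].
apply: le_trans (@integral_prod_expdev _ e a n r _ _ _ _).
- apply: ge0_le_integral => //.
  + by apply/measurable_EFinP; apply: measurableT_comp => //; exact: measurable_tilt.
  + apply/measurable_EFinP; apply: measurable_prod => p /ltr hp.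
    by apply: mexpdev => //; exact: (@measurable_U (e p) hp).
  move=> w _; rewrite lee_fin.
  have ZE i j : (Aw n w - Qw n w) i j = Aw n w i j - Qw n w i j.
    by rewrite [LHS]mxE [X in _ + X]mxE.
  have -> : \prod_(p <- r) expdev (a p) (q (e p) w) (U (e p).1 (e p).2 w) =
     expR (\sum_(p <- r) (a p * (Aw n w - Qw n w) p.1 p.2
       - 2 * (a p) ^+ 2 * Qw n w p.1 p.2)).
    rewrite expR_sum; apply: eq_big_seq => p /ltr hp.
    have [hQ hA] := ltE w hp.
    by rewrite ZE hQ hA /expdev; case: ltP => _.
  rewrite ler_expR /tilt big_enum/=.
  rewrite sum_offdiag; last by move=> i; rewrite ZE Q0 A0 subr0 mulr0.
  rewrite sum_offdiag//.
  rewrite !mulr_sumr -sumrB; apply: ler_sum => p hp.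
  rewrite !ZE (AC w p.2 p.1) (QC w p.2 p.1).
  have : a p ^+ 2 <= (2 * theta) ^+ 2.
    by rewrite -real_normK ?num_real// ler_sqr ?nnegrE// mulr_ge0.
  move=> /(ler_wpM2r (Q_ge0 w p.1 p.2)); rewrite /a; lra.
- by rewrite map_inj_uniq// enum_uniq.
- by rewrite all_map; apply/allP => p /ltr.
- by move=> p; split; exact: ltn_ord.
- move=> p; apply: le_trans (ler_norm _) _; apply: le_trans (aR p) _; lra.
Qed.

(** The union bound as one random variable: when this sum of positive terms is below 1, every
    exponent is negative. Finite functions make the index set a finite type. *)
Definition devsum (theta a : R) (n k : nat) (w : S) : R :=
  \sum_(p : {ffun 'I_n -> 'I_k} * {ffun 'I_k * 'I_k -> bool})
    expR (tilt (fun i j => (-1) ^+ p.2 (p.1 i, p.1 j)) theta w - ls_entropy a n k).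

Lemma devsum_ge0 theta a n k w : 0 <= devsum theta a n k w.
Proof. by apply: sumr_ge0 => p _; exact: expR_ge0. Qed.

Lemma measurable_devsum theta a n k : measurable_fun setT (devsum theta a n k).
Proof.
apply: measurable_sum => p; apply: measurableT_comp => //.
by apply: measurable_funB => //; exact: measurable_tilt.
Qed.

Lemma integral_devsum theta a n k : 0 <= theta <= 4^-1 -> (0 < k)%N ->
  (\int[P]_w (devsum theta a n k w)%:E <= (expR (- (a * n%:R)))%:E)%E.
Proof.
move=> ht k0.
under eq_integral do rewrite -sumEFin.
rewrite ge0_integral_sum//; last first.
  move=> p; apply/measurable_EFinP; apply: measurableT_comp => //.
  by apply: measurable_funB => //; exact: measurable_tilt.
apply: (@le_trans _ _ (\sum_(p : {ffun 'I_n -> 'I_k} * {ffun 'I_k * 'I_k -> bool})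
   (expR (- ls_entropy a n k))%:E)%E).
  apply: lee_sum => p _.
  under eq_integral do rewrite expRD EFinM.
  rewrite ge0_integralZr//.
  - rewrite -[leRHS]mul1e; apply: lee_wpmul2r; first by rewrite lee_fin expR_ge0.
    by apply: integral_exp_tilt => // i j; rewrite normrX normrN1 expr1n.
  - by apply/measurable_EFinP; apply: measurableT_comp => //; exact: measurable_tilt.
rewrite sumEFin lee_fin sumr_const card_prod !card_ffun !card_ord card_prod !card_ord card_bool.
rewrite -[leLHS]mulr_natl natrM !natrX.
have kR : 0 < k%:R :> R by rewrite ltr0n.
have -> : k%:R ^+ n = expR (n%:R * ln k%:R) :> R.
  by rewrite mulrC expRM_natr lnK.
have h2 : 2 ^+ (k * k) <= expR (k%:R ^+ 2) :> R.
  have -> : k%:R ^+ 2 = 1 * (k * k)%:R :> R by rewrite natrM mul1r.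
  rewrite expRM_natr lerXn2r ?nnegrE ?expR_ge0//.
  by have := expR_ge1Dx (1 : R); lra.
apply: (@le_trans _ _ (expR (n%:R * ln k%:R) * expR (k%:R ^+ 2) * expR (- ls_entropy a n k))).
  by rewrite ler_wpM2r ?expR_ge0// ler_wpM2l ?expR_ge0.
rewrite -!expRD ler_expR /ls_entropy; lra.
Qed.

Lemma devsum_lt1 theta a n k w : devsum theta a n k w < 1 ->
  forall (pi : 'I_n -> 'I_k) (s : 'I_k -> 'I_k -> bool),
    theta * (\sum_i \sum_j (-1) ^+ s (pi i) (pi j) * (Aw n w - Qw n w) i j) <=
    4 * theta ^+ 2 * (\sum_i \sum_j Qw n w i j) + ls_entropy a n k.
Proof.
move=> h pi s.
pose p := (finfun pi, [ffun z : 'I_k * 'I_k => s z.1 z.2]).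
have := h; rewrite /devsum (bigD1 p)//= => h1.
have h2 : expR (tilt (fun i j => (-1) ^+ p.2 (p.1 i, p.1 j)) theta w
    - ls_entropy a n k) < 1.
  apply: le_lt_trans h1; rewrite lerDl.
  by apply: sumr_ge0 => ? _; exact: expR_ge0.
rewrite expR_lt1 in h2.
rewrite -subr_le0; apply: le_trans (ltW h2).
rewrite le_eqVlt /tilt opprD addrA; apply/orP; left; apply/eqP.
congr (_ * _ - _ - _); apply: eq_bigr => i _; apply: eq_bigr => j _.
by have -> : p.2 (p.1 i, p.1 j) = s (pi i) (pi j) by rewrite /p/= !ffunE.
Qed.

End ExpMoment.

(** * Variance of the off-diagonal sum of a symmetric kernel *)

Section SecondMoment.
Variables (phi : T * T -> R) (m b1 b2 : R).
Hypotheses (mphi : measurable_fun setT phi) (phi0 : forall z, 0 <= phi z)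
  (phiC : forall x y, phi (x, y) = phi (y, x)) (b1_ge0 : 0 <= b1) (b2_ge0 : 0 <= b2)
  (hm : (\int[mu \x mu]_z (phi z)%:E = m%:E)%E)
  (hb1 : (\int[mu]_x ((\int[mu]_y (phi (x, y))%:E) * (\int[mu]_y (phi (x, y))%:E))
    <= b1%:E)%E)
  (hb2 : (\int[mu \x mu]_z (phi z ^+ 2)%:E <= b2%:E)%E).

Definition ustat (n : nat) (w : S) : R :=
  \sum_(p : 'I_n * 'I_n | p.1 != p.2) phi (X p.1 w, X p.2 w).

Let phiX i j w : R := phi (X i w, X j w).

Let mphiX i j : measurable_fun setT (phiX i j).
Proof.
have mp : measurable_fun setT (fun w => (X i w, X j w)).
  by apply: measurable_fun_pair; exact: measurable_X.
exact: (measurableT_comp mphi mp).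
Qed.

Lemma measurable_ustat n : measurable_fun setT (ustat n).
Proof.
rewrite (_ : ustat n = fun w => \sum_(p : 'I_n * 'I_n)
   if p.1 != p.2 then phiX p.1 p.2 w else 0).
  by apply: measurable_sum => p; case: (p.1 != p.2).
by apply/funext => w; rewrite /ustat big_mkcond.
Qed.

Lemma ustat_ge0 n w : 0 <= ustat n w.
Proof. by apply: sumr_ge0. Qed.

Let mphiE : measurable_fun setT (fun z => (phi z)%:E).
Proof. exact/measurable_EFinP. Qed.

Let phi0E z : (0 <= (phi z)%:E)%E.
Proof. by rewrite lee_fin. Qed.

Local Notation covb := (covbound m b1 b2).
Local Notation covb_b1 := (covbound_b1 m b1_ge0 b2_ge0).
Local Notation covb_b2 := (covbound_b2 m b1_ge0 b2_ge0).

(** Equal unordered pairs give the second moment [b2], one shared index gives the squared marginal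
    [b1], and disjoint pairs factor into [m ^ 2]. Symmetry of [phi] moves the shared index to the
    front. *)
Let cross i j k l : i != j -> k != l ->
  (\int[P]_w (phiX i j w * phiX k l w)%:E <=
   (covb (i == k) (i == l) (j == k) (j == l))%:E)%E.
Proof.
move=> ij kl.
have case2 a b : a != b -> (\int[P]_w (phiX a b w * phiX a b w)%:E <= b2%:E)%E.
  move=> ab; apply: le_trans hb2.
  rewrite -(integral_X2 (f := fun z => (phi z ^+ 2)%:E) _ _ ab)//.
  - by apply/measurable_EFinP; exact: measurable_funX.
  - by move=> z; rewrite lee_fin sqr_ge0.
have case3 a b c : uniq [:: a; b; c] ->
    (\int[P]_w (phiX a b w * phiX a c w)%:E <= b1%:E)%E.
  move=> abc; apply: le_trans hb1.
  rewrite -(integral_X3 mphiE phi0E abc).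
  by under eq_integral do rewrite EFinM.
have XC a b : phiX a b = phiX b a by apply/funext => w; rewrite /phiX phiC.
have [/andP[/eqP ik /eqP jl]|n1] := boolP ((i == k) && (j == l)).
  subst k l; apply: le_trans (case2 _ _ ij) _; rewrite lee_fin.
  by apply: covb_b2; rewrite !eqxx.
have [/andP[/eqP il /eqP jk]|n2] := boolP ((i == l) && (j == k)).
  subst k l; rewrite (XC j i); apply: le_trans (case2 _ _ ij) _; rewrite lee_fin.
  by apply: covb_b2; rewrite !eqxx orbT.
have [ik|nik] := eqVneq i k.
  subst k; rewrite eqxx/= in n1.
  apply: le_trans (case3 i j l _) _; last by rewrite lee_fin; exact: covb_b1.
  by rewrite /= !inE negb_or ij kl n1.
have [il|nil] := eqVneq i l.
  subst l; rewrite eqxx/= in n2; rewrite (XC k i).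
  apply: le_trans (case3 i j k _) _; last by rewrite lee_fin; exact: covb_b1.
  by rewrite /= !inE negb_or ij nik n2.
have [jk|njk] := eqVneq j k.
  subst k; rewrite (XC i j).
  apply: le_trans (case3 j i l _) _; last by rewrite lee_fin; exact: covb_b1.
  by rewrite /= !inE negb_or (eq_sym j i) ij kl nil.
have [jl|njl] := eqVneq j l.
  subst l; rewrite (XC i j) (XC k j).
  apply: le_trans (case3 j i k _) _; last by rewrite lee_fin; exact: covb_b1.
  by rewrite /= !inE negb_or (eq_sym j i) ij njk nik.
under eq_integral do rewrite EFinM.
rewrite (integral_X4 mphiE phi0E); last by rewrite /= !inE !negb_or ij nik nil njk njl kl.
by rewrite hm -EFinM lee_fin /covbound !(mulr0n, addr0, mul0r) -expr2.
Qed.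

(** Here [c] is the mean, [m] times the number of ordered pairs of distinct indices. For each of at
    most [n^2] pairs, each of the four coincidences with a second pair occurs [n] times, and each of
    the two double ones once. *)
Lemma second_moment_ustat n :
  exists2 c : R, 0 <= c <= n%:R ^+ 2 * m &
  (\int[P]_w ((ustat n w - c) ^+ 2)%:E <=
    (4 * n%:R ^+ 3 * b1 + 2 * n%:R ^+ 2 * b2)%:E)%E.
Proof.
have m0 : 0 <= m by rewrite -lee_fin -hm; apply: integral_ge0.
pose nd (p : 'I_n * 'I_n) : R := (p.1 != p.2)%:R.
pose c1 : R := \sum_(p : 'I_n * 'I_n) nd p.
have c1_ge0 : 0 <= c1 by apply: sumr_ge0.
have c1_le : c1 <= n%:R ^+ 2.
  apply: (@le_trans _ _ (\sum_(p : 'I_n * 'I_n) 1)).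
    by apply: ler_sum => p _; rewrite /nd; case: (_ != _).
  by rewrite sumr_const card_prod !card_ord natrM.
exists (c1 * m); first by rewrite mulr_ge0// ler_wpM2r.
set c := c1 * m.
have c0 : 0 <= c by rewrite mulr_ge0.
pose F (p : 'I_n * 'I_n) w : R := nd p * phiX p.1 p.2 w.
have F0 p w : 0 <= F p w by rewrite mulr_ge0// phi0.
have mF p : measurable_fun setT (F p) by apply: measurable_funM.
have SE w : ustat n w = \sum_p F p w.
  rewrite /ustat big_mkcond; apply: eq_bigr => p _; rewrite /F /nd.
  by case: (_ != _); rewrite ?mul1r ?mul0r.
have int_ustat : (\int[P]_w (ustat n w)%:E = c%:E)%E.
  transitivity (\int[P]_w (\sum_p (F p w)%:E))%E.
    by apply: eq_integral => w _; rewrite SE -sumEFin.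
  rewrite ge0_integral_sum//; last 2 first.
  - by move=> p; exact/measurable_EFinP.
  - by move=> p w _; rewrite lee_fin.
  rewrite /c /c1 mulr_suml -sumEFin; apply: eq_bigr => p _; rewrite /F /nd.
  have [e|ne] := eqVneq p.1 p.2.
    by rewrite mul0r; under eq_integral do rewrite mul0r; rewrite integral0.
  rewrite mul1r; under eq_integral do rewrite mul1r.
  by rewrite -hm -(integral_X2 mphiE phi0E (i := p.1) (j := p.2)).
have intSS : (\int[P]_w (ustat n w ^+ 2)%:E <=
    (c ^+ 2 + (4 * n%:R ^+ 3 * b1 + 2 * n%:R ^+ 2 * b2))%:E)%E.
  have FF0 p q w : (0 <= (F p w * F q w)%:E)%E by rewrite lee_fin mulr_ge0.
  have mFF p q : measurable_fun setT (fun w => (F p w * F q w)%:E).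
    by apply/measurable_EFinP; exact: measurable_funM.
  have -> : (\int[P]_w (ustat n w ^+ 2)%:E =
      \int[P]_w (\sum_p \sum_q (F p w * F q w)%:E))%E.
    apply: eq_integral => w _; rewrite SE expr2 mulr_suml -sumEFin.
    by apply: eq_bigr => p _; rewrite mulr_sumr sumEFin.
  rewrite ge0_integral_sum//; last 2 first.
  - by move=> p; apply: emeasurable_sum.
  - by move=> p w _; apply: sume_ge0.
  (* The indicators [nd p * nd q] make the [m ^+ 2] terms add up to exactly [c ^+ 2], which then
     cancels. *)
  pose G (p q : 'I_n * 'I_n) : R := nd p * nd q * m ^+ 2 +
    ((p.1 == q.1)%:R + (p.1 == q.2)%:R + (p.2 == q.1)%:R + (p.2 == q.2)%:R) * b1 +
    ((p.1 == q.1)%:R * (p.2 == q.2)%:R + (p.1 == q.2)%:R * (p.2 == q.1)%:R) * b2.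
  have G0 p q : 0 <= G p q by rewrite /G !(addr_ge0, mulr_ge0)// exprn_ge0.
  apply: (@le_trans _ _ (\sum_p \sum_q (G p q)%:E)%E).
    apply: lee_sum => p _; rewrite ge0_integral_sum//; apply: lee_sum => q _.
    have [e|ne] := eqVneq p.1 p.2.
      have -> : (\int[P]_w (F p w * F q w)%:E = 0)%E.
        by apply: integral0_eq => w _; rewrite /F /nd e eqxx/= !mul0r.
      by rewrite lee_fin.
    have [e'|ne'] := eqVneq q.1 q.2.
      have -> : (\int[P]_w (F p w * F q w)%:E = 0)%E.
        by apply: integral0_eq => w _; rewrite /F /nd e' eqxx/= mul0r mulr0.
      by rewrite lee_fin.
    have -> : (\int[P]_w (F p w * F q w)%:E =
        \int[P]_w (phiX p.1 p.2 w * phiX q.1 q.2 w)%:E)%E.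
      by apply: eq_integral => w _; rewrite /F /nd ne ne' !mul1r.
    apply: le_trans (cross ne ne') _.
    by rewrite lee_fin /covbound /G /nd ne ne' !val_eqE !mul1r.
  have D1 (i : 'I_n) : \sum_(q : 'I_n * 'I_n) (i == q.1)%:R = n%:R :> R.
    rewrite -(pair_bigA _ (fun k l : 'I_n => (i == k)%:R))/=.
    rewrite (bigD1 i)//= [X in _ + X]big1 ?addr0 ?eqxx ?sumr_const ?card_ord//.
    by move=> k /negbTE; rewrite eq_sym => ->; rewrite big1.
  have D2 (i : 'I_n) : \sum_(q : 'I_n * 'I_n) (i == q.2)%:R = n%:R :> R.
    rewrite -(pair_bigA _ (fun k l : 'I_n => (i == l)%:R))/= exchange_big/=.
    rewrite (bigD1 i)//= [X in _ + X]big1 ?addr0 ?eqxx ?sumr_const ?card_ord//.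
    by move=> k /negbTE; rewrite eq_sym => ->; rewrite big1.
  have D3 (i j : 'I_n) : \sum_(q : 'I_n * 'I_n) (i == q.1)%:R * (j == q.2)%:R = 1 :> R.
    rewrite (bigD1 (i, j))//= !eqxx mulr1 [X in _ + X]big1 ?addr0// => -[k l] /=.
    rewrite xpair_eqE negb_and => /orP[]/negbTE; rewrite eq_sym => ->;
    by rewrite ?mul0r ?mulr0.
  have D4 (i j : 'I_n) : \sum_(q : 'I_n * 'I_n) (i == q.2)%:R * (j == q.1)%:R = 1 :> R.
    by apply: etrans (D3 j i); apply: eq_bigr => q _; rewrite mulrC.
  have sG p : \sum_q G p q = nd p * c1 * m ^+ 2 + 4 * n%:R * b1 + 2 * b2.
    rewrite /G !big_split/= -!mulr_suml !big_split/= !D1 !D2 D3 D4 -mulr_sumr -/c1.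
    by ring.
  rewrite (eq_bigr (fun p => (nd p * c1 * m ^+ 2 + 4 * n%:R * b1 + 2 * b2)%:E)).
    2:{ by move=> p _; rewrite sumEFin sG. }
  rewrite sumEFin lee_fin !big_split/= -!mulr_suml -/c1 !sumr_const card_prod !card_ord.
  have nat2 (x : R) : x *+ (n * n) = x * n%:R ^+ 2 by rewrite -[LHS]mulr_natr natrM.
  rewrite !nat2 /c le_eqVlt; apply/orP; left; apply/eqP.
  by ring.
have mS := measurable_ustat n.
have mSE : measurable_fun setT (fun w => (ustat n w)%:E) by exact/measurable_EFinP.
(* The expansion of the square is arranged without subtraction, so that only nonnegative functions
   are integrated in the extended reals. *)
have key : (\int[P]_w ((ustat n w - c) ^+ 2)%:E + (2 * c * c)%:E =
    \int[P]_w (ustat n w ^+ 2)%:E + (c ^+ 2)%:E)%E.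
  have -> : ((2 * c * c)%:E = \int[P]_w ((2 * c)%:E * (ustat n w)%:E))%E.
    rewrite ge0_integralZl//; last 2 first.
    - by move=> w _; rewrite lee_fin ustat_ge0.
    - by rewrite lee_fin mulr_ge0.
    by rewrite int_ustat -EFinM.
  have -> : ((c ^+ 2)%:E = \int[P]_w (c ^+ 2)%:E)%E.
    by rewrite integral_cst//= [X in (_ * X)%E](_ : _ = 1%E) ?mule1//; exact: probability_setT.
  rewrite -!ge0_integralD//.
  - apply: eq_integral => w _; rewrite -EFinM -!EFinD; congr EFin; ring.
  - by move=> w _; rewrite lee_fin sqr_ge0.
  - by apply/measurable_EFinP; exact: measurable_funX.
  - by move=> w _; rewrite lee_fin sqr_ge0.
  - by move=> w _; rewrite lee_fin sqr_ge0.
  - by apply/measurable_EFinP; apply: measurable_funX; exact: measurable_funB.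
  - by move=> w _; rewrite -EFinM lee_fin !mulr_ge0// ustat_ge0.
  - exact: measurable_funeM.
rewrite -(@leeD2rE _ (2 * c * c)%:E)// key.
apply: le_trans (leeD intSS (lexx _)) _.
by rewrite -!EFinD lee_fin; lra.
Qed.

End SecondMoment.

(** * Almost sure boundedness of the mean square of the graphon *)

Section UStatBound.
Variables (W : T -> T -> R) (V : R).
Hypotheses (gW : is_graphon W)
  (hV : (\int[mu \x mu]_z (W z.1 z.2 ^+ 2)%:E = V%:E)%E).

Let f (z : T * T) : R := W z.1 z.2 ^+ 2.
Let g x := (\int[mu]_y (f (x, y))%:E)%E.

Let mf : measurable_fun setT f.
Proof. by case: gW => mW _; exact: measurable_funX. Qed.

Let mfE : measurable_fun setT (fun z => (f z)%:E).
Proof. exact/measurable_EFinP. Qed.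

Let f0 z : 0 <= f z. Proof. exact: sqr_ge0. Qed.

Let f0E z : (0 <= (f z)%:E)%E. Proof. by rewrite lee_fin. Qed.

Let mg : measurable_fun setT g.
Proof. exact: (measurable_fun_fubini_tonelli_F (fun z => (f z)%:E)). Qed.

Let g0 x : (0 <= g x)%E. Proof. exact: integral_ge0. Qed.

Let int_g : (\int[mu]_x g x = V%:E)%E.
Proof. by rewrite -hV fubini_tonelli1. Qed.

Let V0 : 0 <= V. Proof. by rewrite -lee_fin -int_g; exact: integral_ge0. Qed.

Let int_f : (\int[mu \x mu]_z (f z)%:E = V%:E)%E. Proof. exact: hV. Qed.

Let P2 K := (\int[mu]_x psi 2 K (g x))%E.
Let P4 K := (\int[mu \x mu]_z psi 4 K (f z)%:E)%E.

Let P2_ge0 K : (0 <= P2 K)%E.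
Proof. by apply: integral_ge0 => x _; exact: psi_ge0. Qed.

Let P4_ge0 K : (0 <= P4 K)%E.
Proof. by apply: integral_ge0 => x _; exact: psi_ge0. Qed.

Let sum_P2 n : (\sum_(0 <= K < n) P2 K <= (4 * V)%:E)%E.
Proof.
rewrite -ge0_integral_sum//; last 2 first.
- by move=> K; exact: measurable_psi.
- by move=> K x _; exact: psi_ge0.
rewrite EFinM -int_g -ge0_integralZl//.
apply: ge0_le_integral => //.
- by move=> x _; apply: sume_ge0 => K _; exact: psi_ge0.
- by apply: emeasurable_sum => K; exact: measurable_psi.
- exact: measurable_funeM.
- by move=> x _; exact: sum_psi_le.
Qed.

Let sum_P4 n : (\sum_(0 <= K < n) P4 K <= (4 * V)%:E)%E.
Proof.
rewrite -ge0_integral_sum//; last 2 first.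
- by move=> K; exact: measurable_psi.
- by move=> K x _; exact: psi_ge0.
rewrite EFinM -int_f -ge0_integralZl//.
apply: ge0_le_integral => //.
- by move=> x _; apply: sume_ge0 => K _; exact: psi_ge0.
- by apply: emeasurable_sum => K; exact: measurable_psi.
- exact: measurable_funeM.
- by move=> x _; apply: sum_psi_le => //; rewrite ler_nat.
Qed.

Let P2_fin K : (P2 K = (fine (P2 K))%:E)%E.
Proof.
rewrite fineK// ge0_fin_numE//; apply: (@le_lt_trans _ _ (4 * V)%:E); last exact: ltry.
apply: le_trans (sum_P2 K.+1); rewrite big_nat_recr//= leeDr//.
by apply: sume_ge0.
Qed.

Let P4_fin K : (P4 K = (fine (P4 K))%:E)%E.
Proof.
rewrite fineK// ge0_fin_numE//; apply: (@le_lt_trans _ _ (4 * V)%:E); last exact: ltry.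
apply: le_trans (sum_P4 K.+1); rewrite big_nat_recr//= leeDr//.
by apply: sume_ge0.
Qed.

Section Truncation.
Variable K : nat.
Let N := (2 ^ K)%N.
Let NE : N%:R = 2 ^+ K :> R. Proof. by rewrite natrX. Qed.
Let NE4 : N%:R ^+ 2 = 4 ^+ K :> R.
Proof. by rewrite NE -exprM mulnC exprM expr2 -natrM. Qed.
Let N0 : 0 < N%:R :> R. Proof. by rewrite NE exprn_gt0. Qed.

(** The levels match the number of trials: [N] points, so the marginal [g] is cut at [N = 2 ^ K],
    and about [N^2] pairs, so [f] is cut at [N^2 = 4 ^ K]. Both marginals are tested, to keep the
    kernel symmetric. *)
Definition trunc (z : T * T) : R :=
  if [&& f z <= 4 ^+ K, (g z.1 <= (2 ^+ K)%:E)%E & (g z.2 <= (2 ^+ K)%:E)%E]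
  then f z else 0.

Let trunc_ge0 z : 0 <= trunc z. Proof. by rewrite /trunc; case: ifP. Qed.

Let trunc_le z : trunc z <= f z. Proof. by rewrite /trunc; case: ifP. Qed.

Let truncC x y : trunc (x, y) = trunc (y, x).
Proof.
by case: gW => _ [_ Wsym]; rewrite /trunc /f/= Wsym; congr (if _ && _ then _ else _);
  rewrite andbC.
Qed.

Let mtrunc : measurable_fun setT trunc.
Proof.
apply: measurable_fun_ifT => //; apply: measurable_and.
  exact: measurable_fun_ler.
by apply: measurable_and; apply: measurable_fun_lee => //; exact: measurableT_comp.
Qed.

Let mtruncE : measurable_fun setT (fun z => (trunc z)%:E).
Proof. exact/measurable_EFinP. Qed.

Let trunc_ge0E z : (0 <= (trunc z)%:E)%E. Proof. by rewrite lee_fin. Qed.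

Let int_trunc_le : (\int[mu \x mu]_z (trunc z)%:E <= V%:E)%E.
Proof. by rewrite -int_f; apply: ge0_le_integral => // z _; rewrite lee_fin. Qed.

Let mpsi2 : measurable_fun setT (fun x => psi 2 K (g x)).
Proof. exact: measurable_psi. Qed.

Let mpsi4 : measurable_fun setT (fun z => psi 4 K (f z)%:E).
Proof. exact: measurable_psi. Qed.

Let psi2_ge0 x : (0 <= psi 2 K (g x))%E. Proof. exact: psi_ge0. Qed.

Let psi4_ge0 z : (0 <= psi 4 K (f z)%:E)%E. Proof. exact: psi_ge0. Qed.

Let trunc_b1 : (\int[mu]_x ((\int[mu]_y (trunc (x, y))%:E) *
   (\int[mu]_y (trunc (x, y))%:E)) <= (2 ^+ K * fine (P2 K))%:E)%E.
Proof.
have mt : measurable_fun setT (fun x => \int[mu]_y (trunc (x, y))%:E)%E.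
  exact: (measurable_fun_fubini_tonelli_F (fun z => (trunc z)%:E)).
have t0 x : (0 <= \int[mu]_y (trunc (x, y))%:E)%E by exact: integral_ge0.
have k0 : 0 < 2 ^+ K :> R by rewrite exprn_gt0.
rewrite EFinM -P2_fin -ge0_integralZl//.
apply: ge0_le_integral => //.
- by move=> x _; exact: mule_ge0.
- exact: emeasurable_funM.
- by apply: measurable_funeM; exact: measurable_psi.
move=> x _; rewrite /psi; case: ifPn => [gx|ngx].
  have h : (\int[mu]_y (trunc (x, y))%:E <= g x)%E.
    apply: ge0_le_integral => //.
    - exact: measurableT_comp mtruncE (pair1_measurable _).
    - exact: measurableT_comp mfE (pair1_measurable _).
    - by move=> y _; rewrite lee_fin.
  rewrite muleCA -EFinM mulfV ?gt_eqF// mule1.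
  exact: lee_pmul.
have -> : (\int[mu]_y (trunc (x, y))%:E = 0)%E.
  apply: integral0_eq => y _; congr EFin; rewrite /trunc/= (negbTE ngx).
  by rewrite andbF.
by rewrite mul0e -EFinM lee_fin mulr_ge0// ltW.
Qed.

Let trunc_b2 : (\int[mu \x mu]_z (trunc z ^+ 2)%:E <= (4 ^+ K * fine (P4 K))%:E)%E.
Proof.
have k0 : 0 < 4 ^+ K :> R by rewrite exprn_gt0.
rewrite EFinM -P4_fin -ge0_integralZl//.
apply: ge0_le_integral => //.
- by move=> x _; rewrite lee_fin sqr_ge0.
- by apply/measurable_EFinP; exact: measurable_funX.
- by apply: measurable_funeM; exact: measurable_psi.
move=> z _; rewrite /psi lee_fin; case: ifPn => [fz|nfz].
  rewrite -!EFinM lee_fin mulrCA mulfV ?gt_eqF// mulr1 -expr2.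
  by rewrite ler_sqr ?nnegrE.
by rewrite /trunc (negbTE nfz) expr0n/= -EFinM lee_fin mulr_ge0// ltW.
Qed.

Let tail1 (i : nat) (w : S) : R := if (g (X i w) <= (2 ^+ K)%:E)%E then 0 else 1.
Let tail2 (i j : nat) (w : S) : R := if f (X i w, X j w) <= 4 ^+ K then 0 else 1.

Let tail1_ge0 i w : 0 <= tail1 i w. Proof. by rewrite /tail1; case: ifP. Qed.
Let tail2_ge0 i j w : 0 <= tail2 i j w. Proof. by rewrite /tail2; case: ifP. Qed.

Let mtail1 i : measurable_fun setT (tail1 i).
Proof.
apply: measurable_fun_ifT => //; apply: measurable_fun_lee => //.
by apply: measurableT_comp => //; exact: measurable_X.
Qed.

Let mtail2 i j : measurable_fun setT (tail2 i j).
Proof.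
apply: measurable_fun_ifT => //; apply: measurable_fun_ler => //.
apply: measurableT_comp => //.
by apply: measurable_fun_pair; exact: measurable_X.
Qed.

Let int_tail1 i : (\int[P]_w (tail1 i w)%:E <= (fine (P2 K) / N%:R)%:E)%E.
Proof.
pose t x : R := if (g x <= (2 ^+ K)%:E)%E then 0 else 1.
have mt : measurable_fun setT (fun x => (t x)%:E).
  apply/measurable_EFinP; apply: measurable_fun_ifT => //.
  exact: measurable_fun_lee.
rewrite (integral_X i (h := fun x => (t x)%:E))//; last first.
  by move=> x; rewrite lee_fin /t; case: ifP.
rewrite EFinM -P2_fin -ge0_integralZr//.
apply: ge0_le_integral => //.
- by move=> x _; rewrite lee_fin /t; case: ifP.
- by apply: emeasurable_funM => //; exact: measurable_psi.
move=> x _; rewrite /t; case: ifPn => gx.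
  by rewrite mule_ge0 ?psi_ge0// lee_fin invr_ge0 ltW.
by rewrite /psi (negbTE gx) -EFinM -NE lee_fin mulfV// gt_eqF.
Qed.

Let int_tail2 i j : i != j ->
  (\int[P]_w (tail2 i j w)%:E <= (fine (P4 K) / N%:R ^+ 2)%:E)%E.
Proof.
move=> ij.
have N20 : 0 < N%:R ^+ 2 :> R by rewrite exprn_gt0.
pose t z : R := if f z <= 4 ^+ K then 0 else 1.
have t0 z : (0 <= (t z)%:E)%E by rewrite lee_fin /t; case: ifP.
have mt : measurable_fun setT (fun x => (t x)%:E).
  apply/measurable_EFinP; apply: measurable_fun_ifT => //.
  exact: measurable_fun_ler.
rewrite (integral_X2 mt t0 ij).
rewrite EFinM -P4_fin -ge0_integralZr//.
apply: ge0_le_integral => //.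
- by apply: emeasurable_funM => //; exact: measurable_psi.
move=> z _; rewrite /t; case: ifPn => fz.
  by rewrite mule_ge0 ?psi_ge0// lee_fin invr_ge0 ltW.
by rewrite /psi lee_fin (negbTE fz) -EFinM -NE4 lee_fin mulfV// gt_eqF.
Qed.

(** [H] adds the number of points with a large marginal, the number of pairs with a large kernel
    value, and the squared deviation of the truncated sum over [N^4]. If [H w < 1] both counts are
    0, so truncation changed nothing, and the deviation is below [N^2]. The coefficients are [1 + 4]
    and [1 + 2], from the tails and from [second_moment_ustat]. *)
Lemma dyadic_control : exists H : S -> R, [/\ measurable_fun setT H,
  forall w, 0 <= H w,
  (\int[P]_w (H w)%:E <= (5 * fine (P2 K) + 3 * fine (P4 K))%:E)%E &
  forall w, H w < 1 -> \sum_(p : 'I_N * 'I_N | p.1 != p.2)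
     W (X p.1 w) (X p.2 w) ^+ 2 <= (V + 1) * N%:R ^+ 2].
Proof.
have p20 : 0 <= fine (P2 K) by rewrite fine_ge0.
have p40 : 0 <= fine (P4 K) by rewrite fine_ge0.
have mE : (\int[mu \x mu]_z (trunc z)%:E = (fine (\int[mu \x mu]_z (trunc z)%:E))%:E)%E.
  rewrite fineK// ge0_fin_numE; last by apply: integral_ge0.
  by apply: le_lt_trans int_trunc_le _; exact: ltry.
have b10 : 0 <= 2 ^+ K * fine (P2 K) by rewrite mulr_ge0 ?exprn_ge0.
have b20 : 0 <= 4 ^+ K * fine (P4 K) by rewrite mulr_ge0 ?exprn_ge0.
have [c /andP[c0 cle] hc] :=
  second_moment_ustat mtrunc trunc_ge0 truncC b10 b20 mE trunc_b1 trunc_b2 N.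
have cV : c <= V * N%:R ^+ 2.
  apply: le_trans cle _; rewrite mulrC ler_wpM2r ?exprn_ge0//.
  by rewrite -lee_fin -mE.
have N4 : 0 < N%:R ^+ 4 :> R by rewrite exprn_gt0.
pose h1 w := \sum_(i < N) tail1 i w.
pose h2 w := \sum_(p : 'I_N * 'I_N) (if p.1 != p.2 then tail2 p.1 p.2 w else 0).
pose h3 w := (N%:R ^+ 4)^-1 * (ustat trunc N w - c) ^+ 2.
have h10 w : 0 <= h1 w by apply: sumr_ge0.
have h20 w : 0 <= h2 w by apply: sumr_ge0 => p _; case: ifP.
have h30 w : 0 <= h3 w by rewrite mulr_ge0 ?sqr_ge0// invr_ge0 ltW.
have mh1 : measurable_fun setT h1 by apply: measurable_sum => i.
have mh2 : measurable_fun setT h2.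
  by apply: measurable_sum => p; case: (p.1 != p.2).
have mh3 : measurable_fun setT h3.
  apply: measurable_funM => //; apply: measurable_funX.
  by apply: measurable_funB => //; exact: measurable_ustat.
have mU2 : measurable_fun setT (fun w => ((ustat trunc N w - c) ^+ 2)%:E).
  apply/measurable_EFinP; apply: measurable_funX.
  by apply: measurable_funB => //; exact: measurable_ustat.
exists (fun w => h1 w + h2 w + h3 w); split.
- by apply: measurable_funD => //; exact: measurable_funD.
- by move=> w; rewrite !addr_ge0.
- under eq_integral do rewrite !EFinD.
  rewrite ge0_integralD//; last 4 first.
  + by move=> w _; rewrite adde_ge0// lee_fin.
  + by apply: emeasurable_funD; exact/measurable_EFinP.
  + by move=> w _; rewrite lee_fin.
  + exact/measurable_EFinP.
  rewrite ge0_integralD//; last 4 first.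
  + by move=> w _; rewrite lee_fin.
  + exact/measurable_EFinP.
  + by move=> w _; rewrite lee_fin.
  + exact/measurable_EFinP.
  have -> : 5 * fine (P2 K) + 3 * fine (P4 K) = fine (P2 K) + fine (P4 K) +
    (4 * fine (P2 K) + 2 * fine (P4 K)) by ring.
  rewrite 2!EFinD; apply: leeD; first apply: leeD.
  + under eq_integral do rewrite -sumEFin.
    rewrite ge0_integral_sum//; last 2 first.
    * by move=> i; exact/measurable_EFinP.
    * by move=> i w _; rewrite lee_fin.
    apply: (@le_trans _ _ (\sum_(i < N) (fine (P2 K) / N%:R)%:E)%E).
      by apply: lee_sum => i _; exact: int_tail1.
    rewrite sumEFin lee_fin sumr_const card_ord -[leLHS]mulr_natr.
    by rewrite divfK// gt_eqF.
  + under eq_integral do rewrite -sumEFin.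
    rewrite ge0_integral_sum//; last 2 first.
    * by move=> p; apply/measurable_EFinP; case: (p.1 != p.2).
    * by move=> p w _; rewrite lee_fin; case: ifP.
    apply: (@le_trans _ _ (\sum_(p : 'I_N * 'I_N) (fine (P4 K) / N%:R ^+ 2)%:E)%E).
      apply: lee_sum => p _; case: (boolP (p.1 != p.2)) => ne; first exact: int_tail2.
      by rewrite /= integral0 lee_fin divr_ge0 ?exprn_ge0.
    rewrite sumEFin lee_fin sumr_const card_prod card_ord -[leLHS]mulr_natr natrM -expr2.
    by rewrite divfK// gt_eqF// exprn_gt0.
  + under eq_integral do rewrite EFinM.
    rewrite ge0_integralZl//; last first.
      by move=> w _; rewrite lee_fin sqr_ge0.
    apply: le_trans (lee_wpmul2l _ hc) _; first by rewrite lee_fin invr_ge0 ltW.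
    rewrite -EFinM lee_fin -NE4 -NE le_eqVlt; apply/orP; left; apply/eqP.
    by field; rewrite gt_eqF.
move=> w hw.
have h1w : h1 w < 1 by apply: le_lt_trans hw; rewrite -addrA lerDl addr_ge0.
have h2w : h2 w < 1 by apply: le_lt_trans hw; rewrite addrAC lerDr addr_ge0.
have h3w : h3 w < 1 by apply: le_lt_trans hw; rewrite lerDr addr_ge0.
have t1 (i : 'I_N) : (g (X i w) <= (2 ^+ K)%:E)%E.
  apply: contraTT h1w => ng; rewrite -leNgt /h1 (bigD1 i)//= {1}/tail1 (negbTE ng).
  by rewrite lerDl sumr_ge0.
have t2 (p : 'I_N * 'I_N) : p.1 != p.2 -> f (X p.1 w, X p.2 w) <= 4 ^+ K.
  move=> ne; apply: contraTT h2w => nf; rewrite -leNgt /h2 (bigD1 p)//= ne.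
  rewrite {1}/tail2 (negbTE nf) lerDl sumr_ge0// => q _; case: ifP => //.
have -> : \sum_(p : 'I_N * 'I_N | p.1 != p.2) W (X p.1 w) (X p.2 w) ^+ 2 =
    ustat trunc N w.
  by apply: eq_bigr => p ne; rewrite /trunc t2// !t1.
move: h3w; rewrite /h3 ltr_pdivrMl// mulr1 => h3w.
have : ustat trunc N w - c < N%:R ^+ 2.
  rewrite ltNge; apply/negP => h; move: h3w; apply/negP; rewrite -leNgt.
  have -> : N%:R ^+ 4 = (N%:R ^+ 2) ^+ 2 :> R by rewrite -exprM.
  by rewrite ler_sqr ?nnegrE ?exprn_ge0// (le_trans _ h)// exprn_ge0.
move=> h; rewrite mulrDl mul1r; lra.
Qed.

End Truncation.

Lemma ler_sum_ord (F : nat -> R) n n' : (n <= n')%N -> (forall i, 0 <= F i) ->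
  \sum_(i < n) F i <= \sum_(i < n') F i.
Proof.
move=> nn F0; rewrite -!(big_mkord xpredT F) [leRHS](big_cat_nat (leq0n n) nn)/= lerDl.
exact: sumr_ge0.
Qed.

(** The sum is monotone in [n]; passing to the next power of two, at most [2 n], costs the factor
    4. *)
Lemma ae_sum_graphon_sqr : {ae P, forall w, exists n0 : nat, forall n, (n0 <= n)%N ->
  \sum_(i < n) \sum_(j < n | i != j) W (X i w) (X j w) ^+ 2 <=
  4 * (V + 1) * n%:R ^+ 2}.
Proof.
have [H hH] := choice dyadic_control.
have : {ae P, forall w, exists n0 : nat, forall K, (n0 <= K)%N -> H K w < 1}.
  (* [5 * 4 V + 3 * 4 V], by [sum_P2] and [sum_P4]. *)
  apply: (@ae_eventually_lt1 _ _ _ P H (32 * V)).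
  - by move=> K; have [] := hH K.
  - by move=> K; have [] := hH K.
  move=> n.
  apply: (@le_trans _ _ (\sum_(0 <= K < n) (5%:E * P2 K + 3%:E * P4 K))%E).
    apply: lee_sum => K _; have [_ _ + _] := hH K.
    by rewrite EFinD !EFinM -P2_fin -P4_fin.
  rewrite big_split/= -!ge0_sume_distrr//.
  apply: (@le_trans _ _ (5%:E * (4 * V)%:E + 3%:E * (4 * V)%:E)%E).
    by apply: leeD; apply: lee_wpmul2l; rewrite ?lee_fin.
  by rewrite -!EFinM -EFinD lee_fin; lra.
apply: filterS => w [n0 hw]; exists (2 ^ n0)%N => n hn.
have n_gt0 : (0 < n)%N by apply: leq_trans hn; rewrite expn_gt0.
pose K := (trunc_log 2 n).+1.
have /andP[K1 K2] := trunc_log_bounds (isT : (1 < 2)%N) n_gt0.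
have n0K : (n0 <= K)%N.
  by apply/ltnW; rewrite -(ltn_exp2l _ _ (isT : (1 < 2)%N)) (leq_ltn_trans hn).
have [_ _ _ /(_ w (hw K n0K))] := hH K.
pose a i j : R := if i != j then W (X i w) (X j w) ^+ 2 else 0.
have a0 i j : 0 <= a i j by rewrite /a; case: ifP => // _; exact: sqr_ge0.
have aE n' : \sum_(i < n') \sum_(j < n' | i != j) W (X i w) (X j w) ^+ 2 =
    \sum_(i < n') \sum_(j < n') a i j.
  by apply: eq_bigr => i _; rewrite big_mkcond.
have aP n' : \sum_(p : 'I_n' * 'I_n' | p.1 != p.2) W (X p.1 w) (X p.2 w) ^+ 2 =
    \sum_(i < n') \sum_(j < n') a i j.
  by rewrite big_mkcond pair_bigA.
rewrite aE aP => hK.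
apply: (@le_trans _ _ (\sum_(i < 2 ^ K) \sum_(j < 2 ^ K) a i j)).
  apply: le_trans (ler_sum_ord (F := fun i => \sum_(j < 2 ^ K) a i j) (ltnW K2) _).
    by apply: ler_sum => i _; apply: ler_sum_ord => //; exact: ltnW.
  by move=> i; apply: sumr_ge0.
apply: le_trans hK _.
have -> : 4 * (V + 1) * n%:R ^+ 2 = (V + 1) * (2 * n%:R) ^+ 2 by ring.
rewrite ler_wpM2l ?addr_ge0// ler_sqr ?nnegrE ?mulr_ge0// -natrM ler_nat.
by rewrite /K expnS leq_mul2l K1 orbT.
Qed.

Lemma measurable_sum_graphon_sqr n : measurable_fun setT
  (fun w => \sum_(p : 'I_n * 'I_n | p.1 != p.2) W (X p.1 w) (X p.2 w) ^+ 2).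
Proof. exact: (measurable_ustat mf). Qed.

Lemma integral_sum_graphon_sqr n :
  (\int[P]_w (\sum_(p : 'I_n * 'I_n | p.1 != p.2) W (X p.1 w) (X p.2 w) ^+ 2)%:E
    <= (n%:R ^+ 2 * V)%:E)%E.
Proof.
under eq_integral do rewrite big_mkcond -sumEFin.
rewrite ge0_integral_sum//; last 2 first.
- move=> p; apply/measurable_EFinP; case: (p.1 != p.2) => //.
  have mp : measurable_fun setT (fun w => (X p.1 w, X p.2 w)).
    by apply: measurable_fun_pair; exact: measurable_X.
  exact: (measurableT_comp mf mp).
- by move=> p w _; rewrite lee_fin; case: ifP => // _; exact: sqr_ge0.
apply: (@le_trans _ _ (\sum_(p : 'I_n * 'I_n) V%:E)%E).
  apply: lee_sum => p _; case: (boolP (p.1 != p.2)) => ne.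
    by rewrite -int_f -(integral_X2 mfE f0E (i := p.1) (j := p.2)).
  by rewrite /= integral0 lee_fin.
by rewrite sumEFin lee_fin sumr_const card_prod card_ord -[leLHS]mulr_natl natrM.
Qed.

End UStatBound.

End Sampling.

(** * The two bounds *)

Lemma Lnorm2_integral_sqr (R : realType) d (T : measurableType d)
    (m : {measure set T -> \bar R}) (f : T -> R) (L : R) : 0 <= L ->
  ('N[m]_(2%:E)[(fun z => (f z)%:E)] = L%:E)%E ->
  (\int[m]_z (f z ^+ 2)%:E = (L ^+ 2)%:E)%E.
Proof.
move=> L0 hN.
have n2 : (2 : R) != 0 by rewrite pnatr_eq0.
have := poweR_Lnorm m (fun z => (f z)%:E) n2.
rewrite hN poweR_EFin powR_mulrn// => ->.
apply: eq_integral => z _.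
by rewrite /= powR_mulrn// real_normK ?num_real.
Qed.

Section MainBounds.
Context {R : realType} {d : measure_display} {T : measurableType d}
  {mu : probability T R} {dS : measure_display} {S : measurableType dS}
  {P : probability S R} {X : nat -> S -> T} {U : nat -> nat -> S -> R}.
Hypothesis hs : sampling_scheme mu P X U.
Variables (W : T -> T -> R) (V C : R).
Hypotheses (gW : is_graphon W) (C0 : 0 < C) (V0 : 0 <= V)
  (hV : (\int[mu \x mu]_z (W z.1 z.2 ^+ 2)%:E = V%:E)%E).

Let W0 y z : 0 <= W y z. Proof. by case: gW => _ []. Qed.

Let sum_pairs n w :
  \sum_(i < n) \sum_(j < n | i != j) W (X i w) (X j w) ^+ 2 =
  \sum_(p : 'I_n * 'I_n | p.1 != p.2) W (X p.1 w) (X p.2 w) ^+ 2.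
Proof. by rewrite pair_big_dep. Qed.

Let ls_k_gt0 n (kappa : R) : 0 < kappa <= 1 -> 1 < n%:R * kappa ->
  (0 < ls_k n kappa <= n)%N.
Proof.
move=> kp nk; have [m [_ _ _ [-> k1 _]]] := ls_k_bounds kp nk.
rewrite andbT lt0n; apply: contraTneq k1 => ->.
by rewrite mul0r ler10.
Qed.

Lemma LS_bound_in_probability (eps rho kappa : R) n : 0 < eps ->
  0 < rho <= 1 -> 0 < kappa <= 1 -> 1 < n%:R * kappa ->
  (1 + ln (1 / kappa)) / kappa ^+ 2 <= C * (rho * n%:R) ->
  exists A : set S, measurable A /\ ((1 - eps)%:E <= P A)%E /\
    forall w, A w -> LS_bound W rho kappa n (fun i => X i w) (fun i j => U i j w)
      (ls_const C (2 / eps) (2 / eps * (V + 1))).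
Proof.
move=> e0 rp kp nk hC.
have /andP[t0 t1] := ls_theta_le C0 rp kp nk hC.
have /andP[k0 kn] := ls_k_gt0 kp nk.
have r0 : 0 <= rho by case/andP: rp => /ltW.
have nR : 1 <= n%:R :> R by rewrite ler1n (leq_trans k0).
(* Each source of failure receives [eps / 2]: [exp (- a n) <= 1 / (1 + a)] for [n >= 1], and
   Markov's inequality at level [V' n^2]. Using [V + 1] keeps this level positive when [V = 0]. *)
set a := 2 / eps; set V' := a * (V + 1); set th := ls_theta _ _ _ _ in t0 t1.
have a0 : 0 < a by rewrite divr_gt0.
have V'0 : 0 < V' by rewrite mulr_gt0// ltr_wpDl.
have q0 : 0 < V' * n%:R ^+ 2 by rewrite mulr_gt0// exprn_gt0//; lra.
pose S2 w := \sum_(p : 'I_n * 'I_n | p.1 != p.2) W (X p.1 w) (X p.2 w) ^+ 2.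
pose h1 w := devsum (X := X) (U := U) W rho th a n (ls_k n kappa) w.
pose h2 w := (V' * n%:R ^+ 2)^-1 * S2 w.
have S20 w : 0 <= S2 w by apply: sumr_ge0 => p _; exact: sqr_ge0.
have h10 w : 0 <= h1 w by exact: devsum_ge0.
have h20 w : 0 <= h2 w by rewrite mulr_ge0// invr_ge0 ltW.
have mh1 : measurable_fun setT h1 by exact: (measurable_devsum hs).
have mS2 : measurable_fun setT S2 by exact: (measurable_sum_graphon_sqr hs gW).
have mh2 : measurable_fun setT h2 by exact: measurable_funM.
pose h w := h1 w + h2 w.
have mh : measurable_fun setT h by exact: measurable_funD.
have h0 w : 0 <= h w by rewrite addr_ge0.
have inth : (\int[P]_w (h w)%:E <= eps%:E)%E.
  have -> : eps = eps / 2 + eps / 2 by field.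
  rewrite /h; under eq_integral do rewrite EFinD.
  rewrite ge0_integralD//; last 4 first.
  - by move=> w _; rewrite lee_fin.
  - exact/measurable_EFinP.
  - by move=> w _; rewrite lee_fin.
  - exact/measurable_EFinP.
  rewrite EFinD; apply: leeD.
    apply: le_trans (integral_devsum hs gW r0 _ _ _ k0) _.
      by rewrite (ltW t0) t1.
    rewrite lee_fin expRN -[leRHS]invrK lef_pV2 ?posrE ?expR_gt0 ?invr_gt0 ?divr_gt0//.
    rewrite invf_div -/a; apply: le_trans (expR_ge1Dx _).
    have : a <= a * n%:R by rewrite ler_peMr// ltW.
    by lra.
  rewrite /h2; under eq_integral do rewrite EFinM.
  rewrite ge0_integralZl//; last 3 first.
  - exact/measurable_EFinP.
  - by move=> w _; rewrite lee_fin.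
  - by rewrite lee_fin invr_ge0 ltW.
  apply: le_trans (lee_wpmul2l _ (integral_sum_graphon_sqr hs gW hV n)) _.
    by rewrite lee_fin invr_ge0 ltW.
  rewrite -EFinM lee_fin ler_pdivrMl//.
  have -> : V' * n%:R ^+ 2 * (eps / 2) = n%:R ^+ 2 * (V + 1).
    by rewrite /V' /a; field; rewrite gt_eqF.
  by rewrite ler_wpM2l ?exprn_ge0// lerDl.
have mB := measurable_ge1 mh.
exists (~` [set w | 1 <= h w]); split; first exact: measurableC.
split.
  rewrite probability_setC// EFinB; apply: leeB => //.
  by apply: le_trans (markov_ge1 P mh h0) _.
move=> w /= /negP; rewrite -ltNge => hw.
apply: LS_bound_of_deviation => //; [exact: ltW|exact: ltW| |].
  rewrite sum_pairs -/(S2 w).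
  have : h2 w < 1 by apply: le_lt_trans hw; rewrite lerDr.
  by rewrite /h2 ltr_pdivrMl// mulr1 => /ltW.
apply: (devsum_lt1 (theta := th)).
by apply: le_lt_trans hw; rewrite lerDl.
Qed.

Lemma LS_bound_almost_surely (rho : nat -> R) :
  rho @ \oo --> 0 -> (fun n => n%:R * rho n) @ \oo --> +oo ->
  {ae P, forall w, exists N : nat, forall n : nat, (N <= n)%N ->
    forall kappa : R, 0 < kappa <= 1 -> 1 < n%:R * kappa ->
    (1 + ln (1 / kappa)) / kappa ^+ 2 <= C * (rho n * n%:R) ->
    LS_bound W (rho n) kappa n (fun i => X i w) (fun i j => U i j w)
      (ls_const C 2 (4 * (V + 1)))}.
Proof.
move=> rho0 nrho.
have [N1 _ hN1] : \forall n \near \oo, rho n < 1.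
  exact: (cvgr_lt 0 rho0).
have [N2 _ hN2] : \forall n \near \oo, 0 < n%:R * rho n.
  by move/cvgryPgt : nrho; apply.
(* Selects, without reference to [kappa], the class numbers for which the expectation of [devsum] is
   under control; by [ls_theta_le] every [ls_k n kappa] that occurs is among them once
   [0 < rho n <= 1]. *)
pose good n (k : nat) := [&& 0 < rho n <= 1, (0 < k)%N & ls_theta C (rho n) n k <= 4^-1].
pose h n w := \sum_(k < n.+1) (if good n k then
  devsum (X := X) (U := U) W (rho n) (ls_theta C (rho n) n k) 2 n k w else 0).
have h0 n w : 0 <= h n w by apply: sumr_ge0 => k _; case: ifP => // _; exact: devsum_ge0.
have mt n (k : 'I_n.+1) : measurable_fun setT (fun w => if good n k then
  devsum (X := X) (U := U) W (rho n) (ls_theta C (rho n) n k) 2 n k w else 0).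
  by case: (good n k) => //; exact: (measurable_devsum hs).
have mh n : measurable_fun setT (h n) by exact: measurable_sum.
(* With [a = 2] the [n + 1] class numbers cost at most [(n + 1) exp (- 2 n)], which is summable
   since [n + 1 <= 2 * 2^n] and [2 <= e]. *)
have inth n : (\int[P]_w (h n w)%:E <= (2 * 2^-1 ^+ n)%:E)%E.
  rewrite /h; under eq_integral do rewrite -sumEFin.
  rewrite ge0_integral_sum//; last 2 first.
  - by move=> k; exact/measurable_EFinP.
  - by move=> k w _; rewrite lee_fin; case: ifP => // _; exact: devsum_ge0.
  apply: (@le_trans _ _ (\sum_(k < n.+1) (expR (- (2 * n%:R)))%:E)%E).
    apply: lee_sum => k _; case: (boolP (good n k)) => [/and3P[/andP[r0 _] k0 t1]|_].
      by apply: (integral_devsum hs) => //; [exact: ltW|rewrite ls_theta_ge0].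
    by rewrite /= integral0 lee_fin expR_ge0.
  rewrite sumEFin lee_fin sumr_const card_ord -[leLHS]mulr_natl.
  have e2 : 2 ^+ n <= expR n%:R :> R.
    rewrite -[n%:R]mul1r expRM_natr lerXn2r ?nnegrE ?expR_ge0//.
    by have := expR_ge1Dx (1 : R); lra.
  have n2 : n.+1%:R <= 2 * 2 ^+ n :> R.
    by rewrite -exprS -natrX ler_nat ltnW// ltn_expl.
  have e0 := expR_gt0 (n%:R : R).
  have p2 : 0 < 2 ^+ n :> R by rewrite exprn_gt0.
  rewrite expRN ler_pdivrMr ?expR_gt0// exprVn.
  have -> : expR (2 * n%:R) = expR n%:R * expR n%:R :> R.
    by rewrite -expRD; congr expR; ring.
  apply: le_trans n2 _; rewrite -mulrA ler_pM2l//.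
  rewrite ler_pdivlMl// ; apply: ler_pM => //; exact: ltW.
have geo n : \sum_(0 <= k < n) (2 * 2^-1 ^+ k) + 4 * 2^-1 ^+ n = 4 :> R.
  elim: n => [|n IH]; first by rewrite big_nil expr0; ring.
  by rewrite big_nat_recr//= -[RHS]IH exprS; field.
have E2 : {ae P, forall w, exists N : nat, forall n, (N <= n)%N -> h n w < 1}.
  apply: (@ae_eventually_lt1 _ _ _ P h 4) => // n.
  apply: (@le_trans _ _ (\sum_(0 <= k < n) (2 * 2^-1 ^+ k)%:E)%E).
    by apply: lee_sum.
  by rewrite sumEFin lee_fin -[leRHS](geo n) lerDl mulr_ge0// exprn_ge0// invr_ge0.
apply: filterS2 (ae_sum_graphon_sqr hs gW hV) E2 => w [N3 h3] [N4 h4].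
exists (maxn (maxn N1 N2) (maxn N3 N4)) => n.
rewrite !geq_max => /andP[/andP[n1 n2] /andP[n3 n4]] kappa kp nk hC.
have /andP[k0 kn] := ls_k_gt0 kp nk.
have nR : 0 < n%:R :> R by rewrite ltr0n (leq_trans k0).
have rp : 0 < rho n <= 1.
  by have := hN2 n n2; rewrite pmulr_rgt0// => ->; rewrite ltW// hN1.
have /andP[t0 t1] := ls_theta_le C0 rp kp nk hC.
apply: LS_bound_of_deviation => //; [by rewrite mulr_ge0 ?addr_ge0|exact: h3|].
apply: (devsum_lt1 (theta := ls_theta C (rho n) n (ls_k n kappa))).
apply: le_lt_trans (h4 n n4).
have kn1 : (ls_k n kappa < n.+1)%N by [].
rewrite /h (bigD1 (Ordinal kn1))//= /good rp k0 t1/= lerDl.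
by apply: sumr_ge0 => k _; case: ifP => // _; exact: devsum_ge0.
Qed.

End MainBounds.

Unset Implicit Arguments.

Theorem theorem3p2 (R : realType) (Lam C : R) (hLam : 0 <= Lam) (hC : 0 < C) :
  (* part 1: O_p bound, for fixed n *)
  (forall eps : R, 0 < eps ->
    exists M : R,
    forall (d : measure_display) (T : measurableType d) (pi : probability T R)
      (W : T -> T -> R)
      (dS : measure_display) (S : measurableType dS) (P : probability S R)
      (X : nat -> S -> T) (U : nat -> nat -> S -> R)
      (rho kappa : R) (n : nat),
      is_graphon W ->
      ('N[pi \x pi]_(1%:E)[(fun z => (W z.1 z.2)%:E)] = 1)%E ->
      ('N[pi \x pi]_(2%:E)[(fun z => (W z.1 z.2)%:E)] = Lam%:E)%E ->
      sampling_scheme pi P X U ->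
      0 < rho <= 1 -> 0 < kappa <= 1 ->
      1 < n%:R * kappa ->
      (1 + ln (1 / kappa)) / kappa ^+ 2 <= C * (rho * n%:R) ->
      exists A : set S, measurable A /\ ((1 - eps)%:E <= P A)%E /\
        forall w, A w ->
          LS_bound W rho kappa n (fun i => X i w) (fun i j => U i j w) M)
  /\
  (* part 2: almost sure bound along a sequence rho_n *)
  (exists M : R,
    forall (d : measure_display) (T : measurableType d) (pi : probability T R)
      (W : T -> T -> R)
      (dS : measure_display) (S : measurableType dS) (P : probability S R)
      (X : nat -> S -> T) (U : nat -> nat -> S -> R)
      (rho : nat -> R),
      is_graphon W ->
      ('N[pi \x pi]_(1%:E)[(fun z => (W z.1 z.2)%:E)] = 1)%E ->
      ('N[pi \x pi]_(2%:E)[(fun z => (W z.1 z.2)%:E)] = Lam%:E)%E ->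
      sampling_scheme pi P X U ->
      rho @ \oo --> 0 ->
      (fun n => n%:R * rho n) @ \oo --> +oo ->
      {ae P, forall w, exists N : nat, forall n : nat, (N <= n)%N ->
        forall kappa : R, 0 < kappa <= 1 ->
        1 < n%:R * kappa ->
        (1 + ln (1 / kappa)) / kappa ^+ 2 <= C * (rho n * n%:R) ->
        LS_bound W (rho n) kappa n (fun i => X i w) (fun i j => U i j w) M}).
Proof.
split=> [eps e0|].
  exists (ls_const C (2 / eps) (2 / eps * (Lam ^+ 2 + 1))).
  move=> d T pi W dS S P X U rho kappa n gW _ hN hs rp kp nk hk.
  apply: (LS_bound_in_probability hs gW) => //; first exact: sqr_ge0.
  exact: Lnorm2_integral_sqr hN.
exists (ls_const C 2 (4 * (Lam ^+ 2 + 1))).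
move=> d T pi W dS S P X U rho gW _ hN hs rho0 nrho.
apply: (LS_bound_almost_surely hs gW) => //; first exact: sqr_ge0.
exact: Lnorm2_integral_sqr hN.
Qed.
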